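(* Let $0<\delta,\delta'<1$ and $C_R\geq 1$, let $I_0,J_0\subset\mathbb R$ be intervals, let $\Phi\in C^2(I_0\times J_0;\mathbb R)$ satisfy $\partial^2_{xy}\Phi\neq 0$ on $I_0\times J_0$, and let $G\in C^1(I_0\times J_0;\mathbb C)$. Put $$\varepsilon_0:=(5C_R)^{-80\left(\frac1{\delta(1-\delta)}+\frac1{\delta'(1-\delta')}\right)}.$$ Then there exists a constant $C>0$ depending only on $\delta,\delta',C_R,I_0,J_0,\Phi,G$ such that the following holds. For every $h\in(0,1)$, every $(X,\mu_X)$ which is $\delta$-regular up to scale $h$ with constant $C_R$ and satisfies $X\subset I_0$, and every $(Y,\mu_Y)$ which is $\delta'$-regular up to scale $h$ with constant $C_R$ and satisfies $Y\subset J_0$, the operator $\mathcal B_h:L^1(Y,\mu_Y)\to L^\infty(X,\mu_X)$, $$\mathcal B_hf(x)=\int_Y\exp\Big(\frac{i\Phi(x,y)}{h}\Big)G(x,y)f(y)\,d\mu_Y(y),$$ satisfies $$\|\mathcal B_h\|_{L^2(Y,\mu_Y)\to L^2(X,\mu_X)}\leq Ch^{\varepsilon_0}.$$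
   Context: An interval is a set $I=[c,d]\subset\mathbb R$ with $c<d$; its size is $|I|=d-c$ and its center is $(c+d)/2$. Definition ($\delta$-regularity). Let $X\subset\mathbb R$ be compact, $\mu_X$ a finite measure supported on $X$, and $\delta\in[0,1]$. The pair $(X,\mu_X)$ is $\delta$-regular up to scale $h\in[0,1)$ with regularity constant $C_R\geq1$ if: (i) for each interval $I$ of size $|I|\geq h$, $\mu_X(I)\leq C_R|I|^\delta$; (ii) if additionally $|I|\leq 1$ and the center of $I$ lies in $X$, then $\mu_X(I)\geq C_R^{-1}|I|^\delta$. *)

(* Defs.v *)
From HB Require Import structures.
From mathcomp Require Import all_boot all_order all_algebra.
From mathcomp Require Import all_classical all_reals all_analysis.
From mathcomp Require Import complex.

Set Implicit Arguments.
Unset Strict Implicit.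
Unset Printing Implicit Defensive.

Import Order.TTheory GRing.Theory Num.Theory.
Import numFieldNormedType.Exports.

Local Open Scope classical_set_scope.
Local Open Scope ring_scope.
Local Open Scope complex_scope.

(* Derivatives relative to a set: at an endpoint of an interval they are
   one-sided, so that C^1 and C^2 make sense on a closed rectangle without
   extending the function beyond it. *)
Definition derivable_on (R : realType) (I : set R) (f : R -> R) (x : R) : Prop :=
  cvg ((f z - f x) / (z - x) @[z --> within I x^']).

Definition derive_on (R : realType) (I : set R) (f : R -> R) (x : R) : R :=
  lim ((f z - f x) / (z - x) @[z --> within I x^']).

Definition partial_x (R : realType) (I : set R) (F : R -> R -> R) : R -> R -> R :=
  fun x y => derive_on I (fun t => F t y) x.

Definition partial_y (R : realType) (J : set R) (F : R -> R -> R) : R -> R -> R :=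
  fun x y => derive_on J (fun t => F x t) y.

Definition continuous_rect (R : realType) (I J : set R) (F : R -> R -> R) : Prop :=
  {within I `*` J, continuous (fun p : R * R => F p.1 p.2)}.

Definition C1_rect (R : realType) (I J : set R) (F : R -> R -> R) : Prop :=
  [/\ forall x y, I x -> J y ->
        derivable_on I (fun t => F t y) x /\ derivable_on J (fun t => F x t) y,
      continuous_rect I J F,
      continuous_rect I J (partial_x I F) &
      continuous_rect I J (partial_y J F)].

Definition C2_rect (R : realType) (I J : set R) (F : R -> R -> R) : Prop :=
  [/\ C1_rect I J F, C1_rect I J (partial_x I F) & C1_rect I J (partial_y J F)].

Definition C1_rect_complex (R : realType) (I J : set R) (G : R -> R -> R[i]) : Prop :=
  C1_rect I J (fun x y => complex.Re (G x y)) /\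
  C1_rect I J (fun x y => complex.Im (G x y)).

(* [mu] is a Borel measure on the whole line; "supported on X" is
   [mu (~` X) = 0]. *)
Definition regular (R : realType) (delta h CR : R) (X : set R)
    (mu : {finite_measure set (measurableTypeR R) -> \bar R}) : Prop :=
  [/\ 0 <= delta <= 1, 0 <= h < 1 & 1 <= CR] /\
  [/\ compact X,
      mu (~` X) = 0%E,
      forall c d : R, c < d -> h <= d - c ->
        (mu `[c, d]%classic <= (CR * (d - c) `^ delta)%:E)%E &
      forall c d : R, c < d -> h <= d - c -> d - c <= 1 -> X ((c + d) / 2) ->
        ((CR^-1 * (d - c) `^ delta)%:E <= mu `[c, d]%classic)%E].

Definition integralC (R : realType)
    (mu : {finite_measure set (measurableTypeR R) -> \bar R}) (A : set R)
    (f : R -> R[i]) : R[i] :=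
  Rintegral mu A (fun t => complex.Re (f t)) +i*
  Rintegral mu A (fun t => complex.Im (f t)).

(* exp (i t) *)
Definition expi (R : realType) (t : R) : R[i] := cos t +i* sin t.

Definition normL2 (R : realType)
    (mu : {finite_measure set (measurableTypeR R) -> \bar R}) (A : set R)
    (f : R -> R[i]) : \bar R :=
  Lnorm mu 2%:E (EFin \o ((fun t => Normc.normc (f t)) \_ A)).

Definition inL2 (R : realType)
    (mu : {finite_measure set (measurableTypeR R) -> \bar R}) (A : set R)
    (f : R -> R[i]) : Prop :=
  [/\ measurable_fun A (fun t : measurableTypeR R => complex.Re (f t)),
      measurable_fun A (fun t : measurableTypeR R => complex.Im (f t)) &
      (normL2 mu A f < +oo)%E].

(* Square-integrable functions are not quotiented by a.e. equality: both norms
   and the operators below only depend on a.e. classes. *)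
Definition opnormL2 (R : realType)
    (Y : set R) (muY : {finite_measure set (measurableTypeR R) -> \bar R})
    (X : set R) (muX : {finite_measure set (measurableTypeR R) -> \bar R})
    (T : (R -> R[i]) -> R -> R[i]) : \bar R :=
  ereal_sup [set normL2 muX X (T f) |
    f in [set f | inL2 muY Y f /\ (normL2 muY Y f <= 1)%E]].

Definition oscB (R : realType) (Phi : R -> R -> R) (G : R -> R -> R[i])
    (Y : set R) (muY : {finite_measure set (measurableTypeR R) -> \bar R})
    (h : R) (f : R -> R[i]) (x : R) : R[i] :=
  integralC muY Y (fun y => expi (Phi x y / h) * G x y * f y).

Definition eps0 (R : realType) (delta delta' CR : R) : R :=
  (5 * CR) `^
    (- 80 * (1 / (delta * (1 - delta)) + 1 / (delta' * (1 - delta')))).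

(* Main.v *)
Require Import Defs.
From mathcomp Require Import all_boot all_order all_algebra.
From mathcomp Require Import all_classical all_reals all_analysis.
From mathcomp Require Import complex.
From mathcomp Require Import measurable_realfun ring lra.

Set Implicit Arguments.
Unset Strict Implicit.
Unset Printing Implicit Defensive.

Import Order.TTheory GRing.Theory Num.Theory.
Import numFieldNormedType.Exports.

Local Open Scope classical_set_scope.
Local Open Scope ring_scope.
Local Open Scope complex_scope.

(** Dolgopyat's method gives the gain.  Put [A = loss delta delta' CR], so that
    the exponent is [A ^- 80], and fix the ratio [L = A ^ 11] of consecutive
    scales.

    Both sets are cut into cells.  A cell of a set at scale [e] has no hole of
    size [e] but is surrounded by holes of that size, so the cells at scale
    [e / L] refine those at scale [e] ([cell_splits]).  Regularity gives three
    facts, with losses that are powers of [A] ([regular_multiscale]): since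
    the dimension is below [1] the set is porous, and a cell at scale [e] has
    length at most [A ^ 2 * e]; the masses of a cell and of its pieces are
    comparable; since the dimension is above [0], a cell contains two points
    at any prescribed smaller distance, up to a factor [A ^ 2].

    For a cell [J] of [Y] let [amplitude J x] be the integral over [J],
    divided by the mass of [J] and with the phase at an endpoint [J.1] of [J]
    removed.  If [J] splits into pieces [J'], the amplitude of [J] is the mean
    of the amplitudes of the [J'], each turned by the phase
    [(Phi x J'.1 - Phi x J.1) / h] ([amplitude_split]).  Amplitudes are
    measured on a cell [I] of [X] by the larger of the supremum and a suitably
    weighted Lipschitz constant, [sup_lip_norm].  Let the scales [e] of [I]
    and [e'] of [J] satisfy [e * e' * k = h * L], where [k] is the local size
    of the mixed derivative of [Phi].

    Going from [I] to its pieces, the Lipschitz part of the norm improves by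
    itself.  The sup part cannot get worse, by the triangle inequality.  It
    gets strictly better on at least one piece.  Indeed, if a mean of vectors
    is almost as long as possible, then the vectors are aligned.  Choose two
    separated pieces of [J], and two separated pieces of [I].  The relative
    phase of the two amplitudes from [J] turns between the two pieces of [I]
    by an amount given by the mixed derivative ([mixed_difference]), which is
    at most [1] but much larger than what the Lipschitz bound allows the
    amplitudes themselves to vary.  So they cannot be aligned on both pieces
    ([phase_turn_gain]).  As the pieces have comparable masses, the mean
    square of the norm decreases by a factor [1 - A ^- 40] ([one_step]).

    Repeating this while going down in [X] and up in [Y]
    ([iterated_contraction]) gives about [ln (1 / h) / ln L] factors, that is,
    a power of [h] that is more than sufficient ([contraction_rate]).  At the
    smallest scale of [Y] the phase no longer oscillates and amplitudes are
    bounded by means of [|f|] ([amplitude_bound]).  The mixed derivative need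
    not be constant: by uniform continuity it is constant up to a factor two on
    products of short intervals ([local_twist]), and the scales in [X] are
    adapted to its size on each of them ([pair_estimate]).  When [h] is not
    small compared with these intervals the trivial bound suffices. *)

(** * Moduli and phases *)

Notation normc := Normc.normc.

Section Modulus.
Variable R : realType.
Implicit Types (x y z : R[i]) (s t : R).

Lemma normc_ge0 x : 0 <= normc x.
Proof. by case: x => a b; exact: sqrtr_ge0. Qed.

Lemma normc_sqr x : normc x ^+ 2 = complex.Re x ^+ 2 + complex.Im x ^+ 2.
Proof. by case: x => a b /=; rewrite sqr_sqrtr// addr_ge0 ?sqr_ge0. Qed.

Lemma normc_triangle x y : normc (x + y) <= normc x + normc y.
Proof. exact: le_normcD. Qed.

Lemma normcN x : normc (- x) = normc x.
Proof. exact: complex.normcN. Qed.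

Lemma normc_distC x y : normc (x - y) = normc (y - x).
Proof. by rewrite -normcN opprB. Qed.

Lemma normc_dist_triangle y x z : normc (x - z) <= normc (x - y) + normc (y - z).
Proof. by rewrite (le_trans _ (normc_triangle _ _))// subrKA. Qed.

Lemma normc_sum (I : Type) (r : seq I) (P : pred I) (F : I -> R[i]) :
  normc (\sum_(i <- r | P i) F i) <= \sum_(i <- r | P i) normc (F i).
Proof.
apply: (big_ind2 (fun a b => normc a <= b)) => //; first by rewrite Normc.normc0.
by move=> a b c d ab cd; rewrite (le_trans (normc_triangle _ _))// lerD.
Qed.

Lemma normc_real s : normc (s%:C) = `|s|.
Proof. by rewrite /= expr0n/= addr0 sqrtr_sqr. Qed.

Lemma Re_sum (I : Type) (r : seq I) (P : pred I) (F : I -> R[i]) :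
  complex.Re (\sum_(i <- r | P i) F i) = \sum_(i <- r | P i) complex.Re (F i).
Proof. exact: raddf_sum. Qed.

Lemma Im_sum (I : Type) (r : seq I) (P : pred I) (F : I -> R[i]) :
  complex.Im (\sum_(i <- r | P i) F i) = \sum_(i <- r | P i) complex.Im (F i).
Proof. exact: raddf_sum. Qed.

Lemma expi_add s t : expi (s + t) = expi s * expi t.
Proof.
by rewrite /expi sinD cosD; apply/eqP; rewrite eq_complex /= ; apply/andP; split;
  apply/eqP; ring.
Qed.

Lemma expi0 : expi (0 : R) = 1.
Proof. by rewrite /expi cos0 sin0. Qed.

Lemma normc_expi t : normc (expi t) = 1.
Proof. by rewrite /= cos2Dsin2 sqrtr1. Qed.

Lemma normc_expiB s t : normc (expi s - expi t) = 2 * `|sin ((s - t) / 2)|.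
Proof.
have h u : 0 <= 2 * `|sin u : R| by rewrite mulr_ge0.
apply/eqP; rewrite -(@eqrXn2 _ 2%N) ?normc_ge0// normc_sqr exprMn real_normK ?num_real//=.
set u := (s - t) / 2; have -> : s = t + (u + u) by rewrite /u; lra.
have E1 := cos2Dsin2 t; have E2 := cos2Dsin2 u.
rewrite !(cosD, sinD).
have -> : (cos t * (cos u * cos u - sin u * sin u) - sin t * (sin u * cos u + cos u * sin u) - cos t) ^+ 2 +
  (sin t * (cos u * cos u - sin u * sin u) + cos t * (sin u * cos u + cos u * sin u) - sin t) ^+ 2
  = (cos t ^+ 2 + sin t ^+ 2) * ((cos u ^+ 2 + sin u ^+ 2)^+2 + 1 - 2 * (cos u ^+ 2 - sin u ^+ 2)) by ring.
by rewrite E1 E2; apply/eqP; lra.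
Qed.

Lemma sin_diff_mvt t : 0 < t -> exists2 c, 0 < c < t & sin t = cos c * t.
Proof.
move=> t0; have [|c] := @MVT R sin cos 0 t t0 (fun u _ => is_derive_sin u).
  by apply: continuous_subspaceT; exact: continuous_sin.
by rewrite in_itv/= sin0 !subr0 => ? ?; exists c.
Qed.

Lemma norm_sin_le t : `|sin t| <= `|t|.
Proof.
wlog t0 : t / 0 < t => [H|].
  have [t0|t0|->] := ltgtP t 0; last by rewrite sin0.
  - by rewrite -(normrN t) -(normrN (sin t)) -sinN; apply: H; rewrite oppr_gt0.
  - exact: H.
have [c _ ->] := sin_diff_mvt t0.
by rewrite normrM ler_piMl// cos_max.
Qed.

Lemma cos_ge_half t : `|t| <= 1 -> 1 / 2 <= cos t.
Proof.
move=> t1; have -> : t = t / 2 + t / 2 by lra.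
rewrite cosD; have E := cos2Dsin2 (t / 2).
have : `|sin (t / 2)| <= 1 / 2.
  by rewrite (le_trans (norm_sin_le _))// normrM (@ger0_norm _ (2^-1))//; lra.
rewrite ler_norml => /andP[h1 h2]; rewrite -!expr2 in E *; nra.
Qed.

Lemma norm_sin_ge t : `|t| <= 1 -> `|t| / 2 <= `|sin t|.
Proof.
wlog t0 : t / 0 < t => [H t1|].
  have [t0|t0|->] := ltgtP t 0; last by rewrite sin0 normr0 mul0r.
  - by rewrite -(normrN t) -(normrN (sin t)) -sinN; apply: H; rewrite ?oppr_gt0 ?normrN.
  - exact: H.
move=> t1; have [c /andP[c0 ct] ->] := sin_diff_mvt t0.
rewrite normrM mulrC ler_wpM2r//.
have h : 1 / 2 <= cos c.
  apply: cos_ge_half; rewrite gtr0_norm// ltW// (lt_le_trans ct)//.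
  by rewrite (le_trans _ t1)// ler_norm.
by rewrite (le_trans _ (ler_norm _))// -div1r.
Qed.

Lemma expi_dist_le s t : normc (expi s - expi t) <= `|s - t|.
Proof.
by rewrite normc_expiB; have := norm_sin_le ((s - t) / 2);
  rewrite normrM (@ger0_norm _ (2^-1))// => h; lra.
Qed.

(** A factor of two is lost against the chord of a circle: only the order of
    magnitude matters below. *)
Lemma expi_dist_ge s t : `|s - t| <= 1 -> `|s - t| / 2 <= normc (expi s - expi t).
Proof.
move=> st; rewrite normc_expiB; have := @norm_sin_ge ((s - t) / 2).
by rewrite normrM (@ger0_norm _ (2^-1))// => h; have := h ltac:(lra); lra.
Qed.

End Modulus.

(** * Averages of aligned vectors *)

Section Averages.
Variables (R : realType) (T : eqType) (s : seq T) (p : T -> R).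
Hypothesis p_ge0 : forall b, 0 <= p b.
Hypothesis p_sum1 : \sum_(b <- s) p b = 1.

Lemma sum_ge_term (F : T -> R) b : (forall c, 0 <= F c) -> b \in s ->
  F b <= \sum_(c <- s) F c.
Proof.
by move=> F0 bs; rewrite (big_rem b)//= lerDl sumr_ge0// => i _; exact: F0.
Qed.

Lemma variance_real (r : T -> R) :
  \sum_(b <- s) p b * (r b - \sum_(c <- s) p c * r c) ^+ 2 =
  \sum_(b <- s) p b * r b ^+ 2 - (\sum_(b <- s) p b * r b) ^+ 2.
Proof.
set m := \sum_(c <- s) p c * r c.
rewrite (eq_bigr (fun b => p b * r b ^+ 2 - 2 * m * (p b * r b) + m ^+ 2 * p b)); last first.
  by move=> b _; ring.
rewrite big_split/= sumrB -!mulr_sumr p_sum1 -/m; ring.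
Qed.

Lemma variance_term_real (r : T -> R) b : b \in s ->
  p b * (r b - \sum_(c <- s) p c * r c) ^+ 2 <=
  \sum_(c <- s) p c * r c ^+ 2 - (\sum_(c <- s) p c * r c) ^+ 2.
Proof.
move=> bs; rewrite -variance_real.
apply: (@sum_ge_term (fun b => p b * (r b - \sum_(c <- s) p c * r c) ^+ 2)) => // c.
by rewrite mulr_ge0// sqr_ge0.
Qed.

Lemma sqr_mean_le (r : T -> R) :
  (\sum_(c <- s) p c * r c) ^+ 2 <= \sum_(c <- s) p c * r c ^+ 2.
Proof.
rewrite -subr_ge0 -variance_real sumr_ge0// => i _.
by rewrite mulr_ge0// sqr_ge0.
Qed.

(** The variance identity: a mean whose modulus is nearly extremal forces
    every summand that carries some weight to be close to the mean. *)
Lemma variance_term (z : T -> R[i]) b : b \in s ->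
  p b * normc (z b - \sum_(c <- s) (p c)%:C * z c) ^+ 2 <=
  \sum_(c <- s) p c * normc (z c) ^+ 2 - normc (\sum_(c <- s) (p c)%:C * z c) ^+ 2.
Proof.
move=> bs; set Z := \sum_(c <- s) _.
have eRe : complex.Re Z = \sum_(c <- s) p c * complex.Re (z c).
  rewrite Re_sum; apply: eq_bigr => c _; case: (z c) => u v /=; ring.
have eIm : complex.Im Z = \sum_(c <- s) p c * complex.Im (z c).
  rewrite Im_sum; apply: eq_bigr => c _; case: (z c) => u v /=; ring.
under eq_bigr do rewrite normc_sqr mulrDr.
rewrite big_split/= !normc_sqr eRe eIm !raddfB/= eRe eIm.
have := variance_term_real (fun c => complex.Re (z c)) bs.
have := variance_term_real (fun c => complex.Im (z c)) bs.
by rewrite /=; lra.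
Qed.

End Averages.

(** A norm of sup and Lipschitz type, through its upper bounds: [w] weighs
    the Lipschitz constant on [[I.1, I.2]], and is taken proportional to the
    scale of the interval, so that both parts have the same dimension. *)
Definition sup_lip_bound (R : realType) (F : R -> R[i]) (w : R) (I : R * R) (N : R) :=
  [/\ 0 <= N,
      forall x, x \in `[I.1, I.2] -> normc (F x) <= N &
      forall x x', x \in `[I.1, I.2] -> x' \in `[I.1, I.2] ->
        w * normc (F x - F x') <= N * `|x - x'|].

Section Oscillation.
Variables (R : realType) (T : eqType) (s : seq T) (p : T -> R).
Hypothesis p_ge0 : forall b, 0 <= p b.
Hypothesis p_sum1 : \sum_(b <- s) p b = 1.
Variables (w : R) (I : R * R) (F : T -> R -> R[i]) (psi : T -> R -> R) (N : T -> R).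
Hypothesis w_gt0 : 0 < w.
Hypothesis NP : forall b, b \in s -> sup_lip_bound (F b) w I (N b).

Let H x := \sum_(b <- s) (p b)%:C * (expi (psi b x) * F b x).
Let Vsq := \sum_(b <- s) p b * N b ^+ 2.

Let normcE b x : normc (expi (psi b x) * F b x) = normc (F b x).
Proof. by rewrite Normc.normcM normc_expi mul1r. Qed.

Lemma twisted_mean_le x : x \in `[I.1, I.2] ->
  normc (H x) <= \sum_(b <- s) p b * N b.
Proof.
move=> xI; rewrite (le_trans (normc_sum _ _ _))// big_seq [leRHS]big_seq.
apply: ler_sum => b bs; rewrite Normc.normcM normc_real ger0_norm// ler_wpM2l//.
by rewrite normcE; have [_ + _] := NP bs; exact.
Qed.

Let N_ge0 : 0 <= \sum_(b <- s) p b * N b.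
Proof.
by rewrite big_seq sumr_ge0// => b bs; rewrite mulr_ge0//; have [] := NP bs.
Qed.

Lemma twisted_mean_sqr_le x : x \in `[I.1, I.2] -> normc (H x) ^+ 2 <= Vsq.
Proof.
move=> xI; rewrite (le_trans _ (sqr_mean_le p_ge0 p_sum1 N))//.
by rewrite ler_sqr ?nnegrE ?normc_ge0 ?N_ge0// twisted_mean_le.
Qed.

(** The rotating factors contribute their own Lipschitz constant [lam]. *)
Lemma twisted_mean_lip (lam : R) x x' :
  (forall b, b \in s -> `|psi b x - psi b x'| <= lam * `|x - x'|) ->
  x \in `[I.1, I.2] -> x' \in `[I.1, I.2] ->
  w * normc (H x - H x') <= (1 + w * lam) * (\sum_(b <- s) p b * N b) * `|x - x'|.
Proof.
move=> hlam xI xI'; rewrite /H -sumrB.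
rewrite (le_trans (ler_wpM2l (ltW w_gt0) (normc_sum _ _ _)))//.
have -> : (1 + w * lam) * (\sum_(b <- s) p b * N b) * `|x - x'| =
    \sum_(b <- s) p b * ((1 + w * lam) * N b * `|x - x'|).
  by rewrite mulr_sumr mulr_suml; apply: eq_bigr => b _; ring.
rewrite mulr_sumr big_seq [leRHS]big_seq.
apply: ler_sum => b bs; have [N0 N1 N2] := NP bs.
rewrite -mulrBr Normc.normcM normc_real ger0_norm//.
have : normc (expi (psi b x) * F b x - expi (psi b x') * F b x') <=
    normc (F b x - F b x') + `|psi b x - psi b x'| * N b.
  have -> : expi (psi b x) * F b x - expi (psi b x') * F b x' =
     expi (psi b x) * (F b x - F b x') + (expi (psi b x) - expi (psi b x')) * F b x'.
    by ring.
  rewrite (le_trans (normc_triangle _ _))// !Normc.normcM normc_expi mul1r lerD2l.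
  by rewrite ler_pM ?normc_ge0// ?expi_dist_le// N1.
move=> h1; have := N2 _ _ xI xI'.
have h3 := ler_wpM2r N0 (hlam _ bs) => h2.
have h4 : w * normc (expi (psi b x) * F b x - expi (psi b x') * F b x') <=
    N b * `|x - x'| + w * (lam * `|x - x'| * N b).
  rewrite (le_trans (ler_wpM2l (ltW w_gt0) h1))// mulrDr lerD//.
  by rewrite ler_wpM2l ?(ltW w_gt0).
have := ler_wpM2l (p_ge0 b) h4; lra.
Qed.

(** Two summands whose relative phase turns between [x] and [x'] by much more
    than the summands themselves can vary cannot be aligned at both points.
    So the mean is strictly shorter than the bound at one of the two points. *)
Lemma phase_turn_gain (pm g : R) b b' x x' :
  0 < pm <= 1 -> 0 < g <= 1 / 8 ->
  b \in s -> b' \in s -> pm <= p b -> pm <= p b' ->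
  x \in `[I.1, I.2] -> x' \in `[I.1, I.2] ->
  let tau := `|(psi b x - psi b' x) - (psi b x' - psi b' x')| in
  tau <= 1 -> 8 * g + 5 * `|x - x'| / w < tau / 2 ->
  normc (H x) ^+ 2 <= (1 - pm * g ^+ 2) * Vsq \/
  normc (H x') ^+ 2 <= (1 - pm * g ^+ 2) * Vsq.
Proof.
move=> /andP[pm0 pm1] /andP[g0 g8] bs bs' pb pb' xI xI' tau tau1 htau.
have [|hx] := leP (normc (H x) ^+ 2) ((1 - pm * g ^+ 2) * Vsq); first by left.
have [|hx'] := leP (normc (H x') ^+ 2) ((1 - pm * g ^+ 2) * Vsq); first by right.
exfalso.
have Vsq0 : 0 <= Vsq.
  by rewrite sumr_ge0// => i _; rewrite mulr_ge0 ?sqr_ge0.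
pose V := Num.sqrt Vsq.
have V0 : 0 <= V by exact: sqrtr_ge0.
have V2 : V ^+ 2 = Vsq by rewrite sqr_sqrtr.
have Vgt0 : 0 < V.
  rewrite lt0r V0 andbT; apply/eqP => V00.
  have := twisted_mean_sqr_le xI; have := hx; rewrite -V2 V00; lra.
have gpm : pm * g ^+ 2 <= 1 / 64 by nra.
have near1 z c : pm <= p c -> p c * z ^+ 2 < pm * g ^+ 2 * Vsq -> 0 <= z -> z <= g * V.
  move=> pc hz z0; rewrite -ler_sqr ?nnegrE ?mulr_ge0// ?(ltW g0)//.
  rewrite exprMn V2 -(ler_pM2l pm0); apply/ltW; rewrite [ltRHS]mulrA.
  by apply: le_lt_trans hz; rewrite ler_wpM2r// sqr_ge0.
have S_le : \sum_(b <- s) p b * N b <= V.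
  by rewrite -ler_sqr ?nnegrE// V2; exact: (sqr_mean_le p_ge0 p_sum1).
have bound c : c \in s -> pm <= p c -> N c <= 9 / 8 * V.
  move=> cs pc; have := variance_term_real p_ge0 p_sum1 N cs.
  rewrite -/Vsq => hv.
  have : `|N c - \sum_(c0 <- s) p c0 * N c0| <= g * V.
    apply: (near1 _ _ pc) => //; rewrite real_normK ?num_real//.
    rewrite (le_lt_trans hv)// ltrBlDr -ltrBlDl.
    have -> : Vsq - pm * g ^+ 2 * Vsq = (1 - pm * g ^+ 2) * Vsq by ring.
    by rewrite (lt_le_trans hx)// ler_sqr ?nnegrE ?normc_ge0// twisted_mean_le.
  rewrite ler_norml => /andP[_ h]; nra.
have near2 y c : y \in `[I.1, I.2] -> (1 - pm * g ^+ 2) * Vsq < normc (H y) ^+ 2 ->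
    c \in s -> pm <= p c -> normc (expi (psi c y) * F c y - H y) <= g * V.
  move=> yI hy cs pc.
  have := variance_term p_ge0 p_sum1 (fun c => expi (psi c y) * F c y) cs.
  rewrite -/(H y) => hv; apply: (near1 _ _ pc) => //; last exact: normc_ge0.
  rewrite (le_lt_trans hv)//.
  have : \sum_(c0 <- s) p c0 * normc (expi (psi c0 y) * F c0 y) ^+ 2 <= Vsq.
    rewrite /Vsq big_seq [leRHS]big_seq; apply: ler_sum => e es.
    have [N0 N1 _] := NP es.
    by rewrite ler_wpM2l// normcE ler_sqr ?nnegrE ?normc_ge0// N1.
  by move: hy; lra.
have far y c : y \in `[I.1, I.2] -> (1 - pm * g ^+ 2) * Vsq < normc (H y) ^+ 2 ->
    c \in s -> pm <= p c -> V / 2 <= normc (F c y).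
  move=> yI hy cs pc; have := near2 _ _ yI hy cs pc.
  have : 3 / 4 * V <= normc (H y).
    rewrite -ler_sqr ?nnegrE ?normc_ge0 ?mulr_ge0//; try lra.
    by rewrite (le_trans _ (ltW hy))// exprMn V2; nra.
  have := normc_triangle (expi (psi c y) * F c y) (- (expi (psi c y) * F c y - H y)).
  have -> : expi (psi c y) * F c y + - (expi (psi c y) * F c y - H y) = H y by ring.
  rewrite normcN normcE => h1 h2 h3; nra.
pose phi y := psi b y - psi b' y.
have aligned y : y \in `[I.1, I.2] -> (1 - pm * g ^+ 2) * Vsq < normc (H y) ^+ 2 ->
    normc (expi (phi y) * F b y - F b' y) <= 2 * (g * V).
  move=> yI hy; have h1 := near2 _ _ yI hy bs pb; have h2 := near2 _ _ yI hy bs' pb'.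
  have : normc (expi (psi b y) * F b y - expi (psi b' y) * F b' y) <= 2 * (g * V).
    rewrite (le_trans (normc_dist_triangle (H y) _ _))//.
    by rewrite (normc_distC (H y)); lra.
  have -> : expi (psi b y) = expi (psi b' y) * expi (phi y).
    by rewrite -expi_add /phi; congr expi; ring.
  by rewrite -mulrA -mulrBr Normc.normcM normc_expi mul1r.
have lip c : c \in s -> pm <= p c -> normc (F c x - F c x') <= 9 / 8 * V * (`|x - x'| / w).
  move=> cs pc; have [_ _ N2] := NP cs.
  rewrite mulrA ler_pdivlMr// mulrC (le_trans (N2 _ _ xI xI'))//.
  by rewrite ler_wpM2r// bound.
have e1 := aligned _ xI hx; have e2 := aligned _ xI' hx'.
have f1 := lip _ bs pb; have f2 := lip _ bs' pb'.
have turn : normc ((expi (phi x) - expi (phi x')) * F b x) <=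
   4 * (g * V) + 9 / 4 * V * (`|x - x'| / w).
  have -> : (expi (phi x) - expi (phi x')) * F b x =
    (expi (phi x) * F b x - F b' x) - (expi (phi x') * F b x' - F b' x') +
    ((F b' x - F b' x') - expi (phi x') * (F b x - F b x')) by ring.
  have k1 := normc_triangle ((expi (phi x) * F b x - F b' x) - (expi (phi x') * F b x' - F b' x'))
    ((F b' x - F b' x') - expi (phi x') * (F b x - F b x')).
  have k2 := normc_triangle (expi (phi x) * F b x - F b' x) (- (expi (phi x') * F b x' - F b' x')).
  have k3 := normc_triangle (F b' x - F b' x') (- (expi (phi x') * (F b x - F b x'))).
  rewrite normcN in k2; rewrite normcN Normc.normcM normc_expi mul1r in k3.
  by move: k1 k2 k3 e1 e2 f1 f2; set l := `|x - x'| / w; lra.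
rewrite Normc.normcM in turn.
have far1 := far _ _ xI hx bs pb.
have dist : tau / 2 <= normc (expi (phi x) - expi (phi x')) by exact: expi_dist_ge.
have d0 : 0 <= tau by exact: normr_ge0.
have : tau / 2 * (V / 2) <= 4 * (g * V) + 9 / 4 * V * (`|x - x'| / w).
  by rewrite (le_trans _ turn)// ler_pM//; lra.
have l0 : 0 <= `|x - x'| / w by rewrite divr_ge0// ltW.
move: htau; rewrite -mulrA => htau hh.
have : tau / 2 * (V / 2) <= (4 * g + 9 / 4 * (`|x - x'| / w)) * V by lra.
rewrite leNgt => /negP; apply; set l := `|x - x'| / w in l0 htau *; nra.
Qed.

End Oscillation.

(** * Cells of a set at a given scale *)

Section Cells.
Variables (R : realType) (X : set R).
Implicit Types (I J : R * R) (s : seq (R * R)) (e x z : R).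

Definition isolated e I := forall x, X x -> x \notin `[I.1, I.2] ->
  x <= I.1 - e \/ I.2 + e <= x.

(** The last clause tests for holes by windows [[z, z + e]], not by pairs of
    neighbouring points of [X], so that an interval which fails it can be cut
    along the window. *)
Definition cell e I :=
  [/\ I.1 <= I.2, (exists2 x, X x & x \in `[I.1, I.2]), isolated e I &
      forall z, I.1 <= z -> z + e <= I.2 -> exists2 x, X x & x \in `[z, z + e]].

(** Successive cuts along holes of [X].  Parts that miss [X] are dropped, so
    that every piece obtained by [cell_splits] meets [X]. *)
Inductive splits : R * R -> seq (R * R) -> Prop :=
| splits_nil I : (forall x, X x -> x \notin `[I.1, I.2]) -> splits I [::]
| splits_one I : splits I [:: I]
| splits_cut I z z' s s' : I.1 <= z -> z < z' -> z' <= I.2 ->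
    (forall x, X x -> x \notin `[z, z']) ->
    splits (I.1, z) s -> splits (z', I.2) s' -> splits I (s ++ s').

Lemma notin_itvcc x z z' : x \notin `[z, z'] -> x < z \/ z' < x.
Proof.
by rewrite in_itv/= negb_and -!ltNge => /orP.
Qed.

Lemma isolated_cut e I z : 0 < e -> isolated e I -> I.1 <= z -> z + e <= I.2 ->
  (forall x, X x -> x \notin `[z, z + e]) ->
  isolated e (I.1, z) /\ isolated e (z + e, I.2).
Proof.
move=> e0 isoI Iz zI nz; split=> x Xx /notin_itvcc/= h; have hz := notin_itvcc (nz x Xx);
  have [xI|xI] := boolP (x \in `[I.1, I.2]).
- move: xI; rewrite in_itv/= => /andP[? ?]; lra.
- have := isoI x Xx xI; lra.
- move: xI; rewrite in_itv/= => /andP[? ?]; lra.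
- have := isoI x Xx xI; lra.
Qed.

(** Cut at any hole of size [e] as long as there is one; each cut shortens the
    intervals by at least [e]. *)
Lemma cell_splits e I : 0 < e -> isolated e I ->
  exists2 s, splits I s & forall J, J \in s -> cell e J.
Proof.
move=> e0.
have [n] : exists n : nat, I.2 - I.1 <= n%:R * e.
  exists (Num.truncn ((I.2 - I.1) / e)).+1.
  by rewrite -ler_pdivrMr// ltW// truncnS_gt.
elim: n I => [|n IH] I len isoI;
  (have [[y Xy yI]|miss] := pselect (exists2 x, X x & x \in `[I.1, I.2]); last by
    exists [::] => //; apply: splits_nil => x Xx; apply/negP => xI; apply: miss; exists x);
  (have I12 : I.1 <= I.2 by move: yI; rewrite in_itv/= => /andP[]; exact: le_trans);
  (have [win|/existsNP[z]] := pselect (forall z, I.1 <= z -> z + e <= I.2 ->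
   exists2 x, X x & x \in `[z, z + e]); first by
     exists [:: I]; [exact: splits_one | move=> J; rewrite inE => /eqP ->; split => //; exists y]);
  rewrite 2!not_implyE => -[Iz [zI nz]].
  by move: len; rewrite mul0r => len; lra.
have nz' x : X x -> x \notin `[z, z + e].
  by move=> Xx; apply/negP => xz; apply: nz; exists x.
have [iso1 iso2] := isolated_cut e0 isoI Iz zI nz'.
move: len; rewrite -natr1 mulrDl mul1r => len.
have [|s1 sp1 c1] := IH (I.1, z) _ iso1; first by rewrite /=; lra.
have [|s2 sp2 c2] := IH (z + e, I.2) _ iso2; first by rewrite /=; lra.
exists (s1 ++ s2); first by apply: splits_cut sp1 sp2 => //; rewrite ltrDl.
by move=> J; rewrite mem_cat => /orP[/c1|/c2].
Qed.

Lemma splits_sub I s J : splits I s -> J \in s -> I.1 <= J.1 /\ J.2 <= I.2.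
Proof.
elim=> {I s} [//|I|I z z' s s' Iz zz' zI _ _ IH _ IH'].
  by rewrite inE => /eqP ->.
by rewrite mem_cat => /orP[/IH|/IH'] /= []; lra.
Qed.

Lemma splits_cover I s x : splits I s -> X x -> x \in `[I.1, I.2] ->
  exists2 J, J \in s & x \in `[J.1, J.2].
Proof.
elim=> {I s} [I miss /miss /negPf -> //|I _ xI|I z z' s s' Iz zz' zI miss _ IH _ IH' Xx].
  by exists I => //; rewrite inE.
rewrite in_itv/= => /andP[x1 x2].
have [xz|zx] := notin_itvcc (miss x Xx).
  have [|J Js xJ] := IH Xx; first by rewrite in_itv/= x1 ltW.
  by exists J => //; rewrite mem_cat Js.
have [|J Js xJ] := IH' Xx; first by rewrite in_itv/= x2 ltW.
by exists J => //; rewrite mem_cat Js orbT.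
Qed.

(** Serves for masses, for integrals against the kernel, and for integrals of
    [|f| ^ 2] alike. *)
Lemma splits_additive (V : nmodType) (phi : R * R -> V) I s :
  (forall J, (forall x, X x -> x \notin `[J.1, J.2]) -> phi J = 0) ->
  (forall J z z', I.1 <= J.1 -> J.1 <= z -> z < z' -> z' <= J.2 -> J.2 <= I.2 ->
    (forall x, X x -> x \notin `[z, z']) ->
    phi J = phi (J.1, z) + phi (z', J.2)) ->
  splits I s -> phi I = \sum_(J <- s) phi J.
Proof.
move=> phi0 phiD sp; elim: sp phiD => {I s} [I miss _|I _|I z z' s s' Iz zz' zI miss _ IH _ IH' phiD].
- by rewrite big_nil phi0.
- by rewrite big_seq1.
rewrite big_cat/= -IH ?(phiD I z z')// ?IH'//.
- move=> J y y' /= *; apply: phiD => //; lra.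
- move=> J y y' /= *; apply: phiD => //; lra.
Qed.

End Cells.

Definition mass (R : realType) (mu : {finite_measure set (measurableTypeR R) -> \bar R})
  (I : R * R) : R := fine (mu `[I.1, I.2]%classic).

Section Mass.
Variables (R : realType) (X : set R).
Variable mu : {finite_measure set (measurableTypeR R) -> \bar R}.
Hypothesis mX : measurable (X : set (measurableTypeR R)).
Hypothesis muX : mu (~` X) = 0%E.
Implicit Types (I J : R * R).

Lemma massE I : (mass mu I)%:E = mu `[I.1, I.2]%classic.
Proof. by rewrite /mass fineK// fin_num_measure. Qed.

Lemma mass_ge0 I : 0 <= mass mu I.
Proof. by rewrite fine_ge0. Qed.

Lemma null_miss (S : set R) : measurable (S : set (measurableTypeR R)) ->
  (forall x, X x -> ~ S x) -> mu S = 0%E.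
Proof.
move=> mS miss; apply: (@subset_measure0 _ _ _ mu _ (~` X)) => //.
  exact: measurableC.
by move=> x Sx Xx; exact: (miss x Xx).
Qed.

Lemma mass_le_on I (S : set R) : measurable (S : set (measurableTypeR R)) ->
  (forall x, X x -> x \in `[I.1, I.2] -> S x) -> (mu `[I.1, I.2]%classic <= mu S)%E.
Proof.
move=> mS IS.
have mI : measurable (`[I.1, I.2]%classic : set (measurableTypeR R)) by exact: measurable_itv.
rewrite (@le_trans _ _ (mu (S `|` (`[I.1, I.2]%classic `\` S))))//.
  apply: le_measure; rewrite ?inE//.
  - by apply: measurableU => //; exact: measurableD.
  - by move=> x Ix; have [Sx|nSx] := pselect (S x); [left|right].
rewrite measureU//; [|exact: measurableD|by apply/seteqP; split => // x [? []]].
rewrite [X in (_ + X)%E]null_miss ?adde0//; first exact: measurableD.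
by move=> x Xx [/= /(IS _ Xx)].
Qed.

Lemma mass_mono I J : (forall x, X x -> x \in `[I.1, I.2] -> x \in `[J.1, J.2]) ->
  mass mu I <= mass mu J.
Proof.
move=> IJ; rewrite -lee_fin !massE mass_le_on//; exact: measurable_itv.
Qed.

Lemma mass_miss I : (forall x, X x -> x \notin `[I.1, I.2]) -> mass mu I = 0.
Proof.
move=> miss; rewrite /mass null_miss//.
by move=> x Xx xI; have := miss x Xx; rewrite xI.
Qed.

Lemma mass_disjoint_le I J K : I.2 < J.1 -> K.1 <= I.1 -> J.2 <= K.2 -> J.1 <= J.2 -> I.1 <= I.2 ->
  mass mu I + mass mu J <= mass mu K.
Proof.
move=> IJ KI JK J12 I12; rewrite -lee_fin EFinD !massE -measureU.
- apply: le_measure; rewrite ?inE//; [exact: measurableU|].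
  by move=> x /= []; rewrite !in_itv/= => /andP[? ?]; apply/andP; split; lra.
- exact: measurable_itv.
- exact: measurable_itv.
- by apply/seteqP; split => // x []/=; rewrite !in_itv/= => /andP[? ?] /andP[? ?]; lra.
Qed.

Lemma mass_splits I s : splits X I s -> mass mu I = \sum_(J <- s) mass mu J.
Proof.
apply: splits_additive; first exact: mass_miss.
move=> J z z' _ Jz zz' zJ _ miss; apply: le_anti; rewrite mass_disjoint_le//= andbT.
rewrite -lee_fin EFinD !massE -measureU; [|exact: measurable_itv..|].
  apply: mass_le_on; first exact: measurableU.
  move=> x Xx; rewrite /= !in_itv/= => /andP[? ?].
  by have [?|?] := notin_itvcc (miss x Xx); [left|right]; apply/andP; split; lra.
by apply/seteqP; split => // x []/=; rewrite !in_itv/= => /andP[? ?] /andP[? ?]; lra.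
Qed.

End Mass.

(** * Regular measures across scales *)

Section Multiscale.
Variable R : realType.
Implicit Types (I J : R * R) (X : set R) (A h e r x : R).

(** What the argument uses of a regular measure, with one constant [A] for all
    of the losses. *)
Definition multiscale A h X (mu : {finite_measure set (measurableTypeR R) -> \bar R}) :=
  [/\ measurable (X : set (measurableTypeR R)), mu (~` X) = 0%E &
    [/\ forall e I, h <= e <= 1 -> cell X e I -> I.2 - I.1 <= A ^+ 2 * e,
      forall e I, h <= e <= 1 -> cell X e I -> 0 < mass mu I,
      forall e e' I J, h <= e' <= e -> e <= 1 -> cell X e I -> cell X e' J ->
        e' / e * mass mu I <= A ^+ 3 * mass mu J &
      forall e r I, h <= r * e -> 0 < e <= 1 -> 0 < r -> A ^+ 2 * r <= 1 / 2 -> cell X e I ->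
        exists x x', [/\ X x, X x', x \in `[I.1, I.2], x' \in `[I.1, I.2] &
          r * e <= `|x - x'| <= A ^+ 2 * r * e] ]].

Section FromRegular.
Variables (delta h CR A : R) (X : set R).
Variable mu : {finite_measure set (measurableTypeR R) -> \bar R}.
Hypothesis delta01 : 0 < delta < 1.
Hypothesis h_gt0 : 0 < h.
Hypothesis reg : regular delta h CR X mu.
Hypothesis A_ge1 : 1 <= A.
Hypothesis A_len : (6 * CR ^+ 2) `^ (1 - delta)^-1 <= A ^+ 2.
Hypothesis A_sep : (5 * CR) `^ (2 / delta) <= A ^+ 2.
Hypothesis A_mass : CR ^+ 2 <= A.

Let CR1 : 1 <= CR. Proof. by case: reg => -[]. Qed.
Let CR0 : 0 < CR. Proof. by rewrite (lt_le_trans ltr01). Qed.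

Lemma regular_measurable : measurable (X : set (measurableTypeR R)).
Proof. by case: reg => _ [cX _ _ _]; exact: measurable_realfun.compact_measurable. Qed.
Let mX := regular_measurable.

Lemma regular_null : mu (~` X) = 0%E.
Proof. by case: reg => _ []. Qed.
Let muX := regular_null.

Lemma regular_mass_le I l : 0 < l -> h <= l -> I.2 - I.1 <= l ->
  mass mu I <= CR * l `^ delta.
Proof.
move=> l0 hl Il; case: reg => _ [_ _ up _].
have := up I.1 (I.1 + l) ltac:(lra) ltac:(lra).
rewrite -(massE mu (I.1, I.1 + l)) lee_fin addrAC subrr add0r.
apply: le_trans; apply: (mass_mono mX muX) => x _; rewrite !in_itv/= => /andP[? ?].
by apply/andP; split; lra.
Qed.

Lemma regular_mass_ge x e : h <= e <= 1 -> X x ->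
  CR^-1 * e `^ delta <= mass mu (x - e / 2, x + e / 2).
Proof.
move=> /andP[he e1] Xx; case: reg => _ [_ _ _ lo].
have e0 : 0 < e by rewrite (lt_le_trans h_gt0).
rewrite -lee_fin massE /=.
have := lo (x - e / 2) (x + e / 2) ltac:(lra) ltac:(lra) ltac:(lra).
have -> : (x - e / 2 + (x + e / 2)) / 2 = x by lra.
have -> : x + e / 2 - (x - e / 2) = e by lra.
exact.
Qed.

Lemma cell_absorbs e I x x' : cell X e I -> X x -> x \in `[I.1, I.2] ->
  X x' -> `|x - x'| < e -> x' \in `[I.1, I.2].
Proof.
move=> [I12 _ iso _] Xx; rewrite in_itv/= => /andP[xI xI'] Xx' xx'.
have [//|nI] := boolP (x' \in _).
have := iso x' Xx' nI; move: xx'; rewrite ltr_norml => /andP[]; lra.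
Qed.

Lemma cell_mass_ge e I : h <= e <= 1 -> cell X e I -> CR^-1 * e `^ delta <= mass mu I.
Proof.
move=> he cI; have [_ [x Xx xI] _ _] := cI.
rewrite (le_trans (regular_mass_ge he Xx))//; apply: (mass_mono mX muX) => x' Xx'.
rewrite in_itv/= => /andP[? ?]; apply: (cell_absorbs cI Xx xI Xx').
have e0 : 0 < e by move: he => /andP[? _]; rewrite (lt_le_trans h_gt0).
by rewrite ltr_norml; apply/andP; split; lra.
Qed.

(** A point of [X] in the middle third of each window of length [3 * e]
    carries its own ball of radius [e / 2]; these balls are disjoint. *)
Lemma cell_mass_windows e I (n : nat) : h <= e <= 1 -> cell X e I ->
  I.1 + 3 * e * n%:R <= I.2 ->
  n%:R * (CR^-1 * e `^ delta) <= mass mu (I.1, I.1 + 3 * e * n%:R).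
Proof.
move=> he [I12 _ _ win]; have e0 : 0 < e by move: he => /andP[? _]; rewrite (lt_le_trans h_gt0).
elim: n => [|n IH] nI; first by rewrite mul0r mass_ge0.
move: nI; rewrite -natr1 => nI.
have {}IH := IH ltac:(nra).
have [||x Xx] := win (I.1 + 3 * e * n%:R + e); [have := ler0n R n; nra|lra|].
rewrite in_itv/= => /andP[x1 x2].
rewrite -natr1 mulrDl mul1r (le_trans (lerD IH (regular_mass_ge he Xx)))//.
apply: mass_disjoint_le => //=; try lra.
have := ler0n R n; nra.
Qed.

(** Since [delta < 1], the mass of many consecutive windows grows faster than
    regularity allows: this is the porosity of [X]. *)
Lemma cell_length e I : h <= e <= 1 -> cell X e I -> I.2 - I.1 <= A ^+ 2 * e.
Proof.
move=> he cI; have [I12 _ _ _] := cI.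
have e0 : 0 < e by move: he => /andP[? _]; rewrite (lt_le_trans h_gt0).
have d0 : 0 < 1 - delta by move: delta01 => /andP[? ?]; lra.
pose u := (I.2 - I.1) / e.
have u0 : 0 <= u by rewrite divr_ge0 ?subr_ge0// ltW.
have uE : I.2 - I.1 = u * e by rewrite divfK// gt_eqF.
clearbody u; rewrite uE ler_pM2r//.
have C6 : 6 <= A ^+ 2.
  rewrite (le_trans _ A_len)//.
  have c6 : 6 <= 6 * CR ^+ 2 by rewrite ler_peMr ?exprn_ege1.
  rewrite (le_trans c6)// -{1}(@powRr1 _ (6 * CR ^+ 2)); last by lra.
  by rewrite ler_powR//; [lra|rewrite -invr1 lef_pV2 ?posrE//; move: delta01 => /andP[? ?]; lra].
have [|u6] := leP u 6; first by lra.
rewrite (le_trans _ A_len)//.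
have [n /andP[n1 n2]] : exists n : nat, n%:R <= u / 3 < n.+1%:R.
  by exists (Num.truncn (u / 3)); rewrite truncn_itv// divr_ge0.
have := cell_mass_windows (n := n) he cI.
rewrite -(natr1 n) in n2.
have nl : I.1 + 3 * e * n%:R <= I.2 by nra.
move=> /(_ nl) m1.
have m2 := @regular_mass_le (I.1, I.1 + 3 * e * n%:R) (u * e).
have ue0 : 0 < u * e by rewrite mulr_gt0//; lra.
have {}m2 := m2 ue0 ltac:(move: he => /andP[? _]; nra) ltac:(rewrite /=; nra).
have ed : 0 < e `^ delta by rewrite powR_gt0.
have : n%:R * CR^-1 <= CR * u `^ delta.
  rewrite -(ler_pM2r ed) -mulrA (le_trans m1)// (le_trans m2)//.
  by rewrite powRM// ?(ltW e0)// mulrA.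
have n6 : u / 6 <= n%:R by lra.
move=> m3.
have m4 : u <= 6 * CR ^+ 2 * u `^ delta.
  have : n%:R <= CR ^+ 2 * u `^ delta.
    by rewrite ler_pdivrMr// in m3; lra.
  by lra.
have ud : 0 < u `^ delta by rewrite powR_gt0// (lt_trans _ u6).
have m5 : u `^ (1 - delta) <= 6 * CR ^+ 2.
  rewrite powRD; last by apply/implyP => _; rewrite gt_eqF// (lt_trans _ u6).
  by rewrite powRr1// powRN ler_pdivrMr.
have -> : u = (u `^ (1 - delta)) `^ (1 - delta)^-1.
  by rewrite -powRrM divff ?powRr1// gt_eqF.
by apply: ge0_ler_powR => //; rewrite ?nnegrE ?powR_ge0// ?invr_ge0 ?(ltW d0)//; nra.
Qed.

(** The ratio of the masses is at least [(e' / e) ^ delta] up to powers of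
    [A], and [e' / e] is smaller still. *)
Lemma cell_mass_ratio e e' I J : h <= e' <= e -> e <= 1 -> cell X e I -> cell X e' J ->
  e' / e * mass mu I <= A ^+ 3 * mass mu J.
Proof.
move=> /andP[he' e'e] e1 cI cJ.
have e'0 : 0 < e' by rewrite (lt_le_trans h_gt0).
have e0 : 0 < e by lra.
have he : h <= e <= 1 by apply/andP; split; lra.
have he1 : h <= e' <= 1 by apply/andP; split; lra.
have A2 : 1 <= A ^+ 2 by rewrite exprn_ege1.
have m1 := @regular_mass_le I (A ^+ 2 * e) ltac:(nra) ltac:(move/andP: he => [? _]; nra) (cell_length he cI).
have m2 := cell_mass_ge he1 cJ.
have [d0 d1] : 0 < delta /\ delta < 1 by move/andP: delta01.
have p1 : (A ^+ 2) `^ delta <= A ^+ 2.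
  by rewrite -[leRHS]powRr1 ?ler_powR//; [lra|rewrite (le_trans _ A2)].
have ed : 0 < e `^ delta by rewrite powR_gt0.
have ed' : 0 < e' `^ delta by rewrite powR_gt0.
have p2 : e' / e <= e' `^ delta / e `^ delta.
  have -> : e' `^ delta / e `^ delta = (e' / e) `^ delta.
    rewrite -[in LHS](@divfK _ e _ e') ?gt_eqF// [in LHS]powRM ?divr_ge0 ?(ltW e0) ?(ltW e'0)//.
    by rewrite mulfK// gt_eqF.
  rewrite -[leLHS]powRr1; last by rewrite divr_ge0// ltW.
  apply: ger_powR; last exact: ltW.
  by rewrite divr_gt0//= ler_pdivrMr// mul1r.
rewrite powRM ?exprn_ge0 ?(ltW e0)// in m1; last exact: (le_trans ler01 A_ge1).
have q : 0 <= e' / e by rewrite divr_ge0// ltW.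
have m3 : mass mu I <= CR * A ^+ 2 * e `^ delta.
  by rewrite (le_trans m1)// -[leRHS]mulrA ler_pM2l// ler_pM2r.
have m4 : e' `^ delta <= CR * mass mu J by rewrite -ler_pdivrMl.
have -> : A ^+ 3 * mass mu J = A * (A ^+ 2 * mass mu J) by ring.
have m5 : e' / e * mass mu I <= CR * A ^+ 2 * e' `^ delta.
  rewrite (le_trans (ler_pM q (mass_ge0 _ _) p2 m3))//.
  by rewrite le_eqVlt; apply/orP; left; apply/eqP; field; rewrite gt_eqF.
have M0 := mass_ge0 mu J.
have A20 : 0 <= A ^+ 2 by lra.
rewrite (le_trans m5)// (@le_trans _ _ (CR * A ^+ 2 * (CR * mass mu J)))//.
  by rewrite ler_wpM2l// mulr_ge0// ltW.
have -> : CR * A ^+ 2 * (CR * mass mu J) = CR ^+ 2 * (A ^+ 2 * mass mu J) by ring.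
by rewrite ler_wpM2r// mulr_ge0.
Qed.

(** The ball of radius [A ^+ 2 * r * e] around a point of [X] has more mass
    than the one of radius [r * e]: some point of [X] lies in between. *)
Lemma cell_separated_points e r I : h <= r * e -> 0 < e <= 1 -> 0 < r -> A ^+ 2 * r <= 1 / 2 ->
  cell X e I ->
  exists x x', [/\ X x, X x', x \in `[I.1, I.2], x' \in `[I.1, I.2] &
          r * e <= `|x - x'| <= A ^+ 2 * r * e].
Proof.
move=> hre /andP[e0 e1] r0 r1 cI; have [_ [x Xx xI] _ _] := cI.
have A2 : 1 <= A ^+ 2 by rewrite exprn_ege1.
have [d0 d1] : 0 < delta /\ delta < 1 by move/andP: delta01.
have [A1 C1 h0] : [/\ 1 <= A, 1 <= CR & 0 < h] by split.
have [a aE] : exists a, a = r * e by exists (r * e).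
rewrite -(mulrA (A ^+ 2)) -aE in hre *.
have a0 : 0 < a by rewrite aE mulr_gt0.
have b1 : 2 * (A ^+ 2 * a) <= 1 by rewrite aE; nra.
have lo := @regular_mass_ge x (2 * (A ^+ 2 * a)) ltac:(apply/andP; split; nra) Xx.
have up := @regular_mass_le (x - a, x + a) (2 * a) ltac:(lra) ltac:(lra) ltac:(rewrite /=; lra).
have key : mass mu (x - a, x + a) < mass mu (x - A ^+ 2 * a, x + A ^+ 2 * a).
  rewrite (le_lt_trans up)//.
  have -> : A ^+ 2 * a = 2 * (A ^+ 2 * a) / 2 by lra.
  rewrite (lt_le_trans _ lo)// (mulrCA 2) [in ltRHS]powRM ?mulr_ge0 ?exprn_ge0 ?(le_trans ler01 A1) ?(ltW a0)//.
  have ad : 0 < (2 * a) `^ delta by rewrite powR_gt0//; lra.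
  rewrite mulrA ltr_pM2r// -ltr_pdivrMl ?invr_gt0// invrK.
  have : (5 * CR) ^+ 2 <= (A ^+ 2) `^ delta.
    rewrite -[leLHS]powR_mulrn//; last by lra.
    have -> : (2%:R : R) = 2 / delta * delta by rewrite divfK// gt_eqF.
    rewrite powRrM; apply: ge0_ler_powR => //; rewrite ?nnegrE ?powR_ge0 ?(ltW d0)//.
    by lra.
  by apply: lt_le_trans; nra.
have [[x' Xx' /andP[x1 x2]]|none] := pselect (exists2 x', X x' & a < `|x - x'| <= A ^+ 2 * a).
  exists x, x'; split => //; last by rewrite ltW.
  apply: (cell_absorbs cI Xx xI Xx'); rewrite (le_lt_trans x2)//.
  by rewrite aE mulrA; nra.
exfalso; move: key; apply/negP; rewrite -leNgt; apply: (mass_mono mX muX) => x' Xx' /=.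
rewrite !in_itv/= => /andP[h1 h2].
have [|xa] := leP `|x - x'| a; first by rewrite ler_norml => /andP[? ?]; apply/andP; split; lra.
exfalso; apply: none; exists x' => //; rewrite xa/= ler_norml; apply/andP; split; lra.
Qed.

Lemma regular_multiscale : multiscale A h X mu.
Proof.
split => //; split.
- exact: cell_length.
- move=> e I he cI; rewrite (lt_le_trans _ (cell_mass_ge he cI))// mulr_gt0 ?invr_gt0//.
  by rewrite powR_gt0//; move/andP: he => [? _]; rewrite (lt_le_trans h_gt0).
- exact: cell_mass_ratio.
- exact: cell_separated_points.
Qed.

End FromRegular.
End Multiscale.

(** * One-sided derivatives *)

Section Calculus.
Variable R : realType.
Implicit Types (I J : set R) (f : R -> R) (F : R -> R -> R) (e x y z : R).

Lemma derivable_on_eps I f x e : derivable_on I f x -> 0 < e ->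
  exists2 r : R, 0 < r & forall z, I z -> z != x -> `|z - x| < r ->
    `|(f z - f x) / (z - x) - derive_on I f x| < e.
Proof.
move=> df e0; have /cvgrPdist_lt/(_ e e0) := df.
case/nbhs_ballP => r /= r0 hr; exists r => // z Iz zx zr.
rewrite distrC; apply: hr => //.
  by rewrite /ball/= distrC.
Qed.

Lemma continuous_rect_eps I J F x y e : continuous_rect I J F -> I x -> J y -> 0 < e ->
  exists2 r : R, 0 < r & forall x' y', I x' -> J y' -> `|x - x'| < r -> `|y - y'| < r ->
    `|F x y - F x' y'| < e.
Proof.
move=> cF Ix Jy e0.
have /(_ (x, y) (conj Ix Jy)) := (subspace_continuousP _ _).1 cF.
move=> /cvgrPdist_lt/(_ e e0) /nbhs_ballP[r /= r0 hr]; exists r => // x' y' Ix' Jy' xx' yy'.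
exact: (hr (x', y')).
Qed.


Lemma derivable_on_continuous I f : (forall x, I x -> derivable_on I f x) ->
  {within I, continuous f}.
Proof.
move=> df; apply/subspace_continuousP => x Ix; apply/cvgrPdist_lt => e e0.
have [r r0 hr] := derivable_on_eps (df x Ix) ltr01.
set D := derive_on I f x in hr.
have D1 : 0 < `|D| + 1 by rewrite ltr_wpDl.
have d0 : 0 < Num.min r (e / (`|D| + 1)) by rewrite lt_min r0 divr_gt0.
apply/nbhs_ballP; exists (Num.min r (e / (`|D| + 1))) => // z; rewrite /ball/= lt_min => /andP[zr ze] Iz.
have [->|zx] := eqVneq z x; first by rewrite subrr normr0.
have zx0 : z - x != 0 by rewrite subr_eq0.
rewrite distrC in zr; have := hr z Iz zx zr.
rewrite ltr_pdivlMr// in ze.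
have q := ler_normD D ((f z - f x) / (z - x) - D).
rewrite (addrC D) subrK in q.
have -> : f x - f z = - ((f z - f x) / (z - x)) * (z - x) by rewrite mulNr divfK// opprB.
rewrite normrM normrN (distrC z) => h; apply: le_lt_trans ze.
by rewrite mulrC ler_wpM2l//; lra.
Qed.

Lemma derivable_on_is_derive I f x : derivable_on I f x -> nbhs x I ->
  is_derive x 1 f (derive_on I f x).
Proof.
move=> df nI.
suff key : h^-1 *: ((f \o shift x) (h *: 1) - f x) @[h --> (0 : R)^'] --> derive_on I f x.
  by split; [apply: cvgP key | apply/cvg_lim => //; exact: key].
apply/cvgrPdist_lt => e e0; have [r r0 hr] := derivable_on_eps df e0.
case/nbhs_ballP: nI => r' /= r'0 hr'.
apply/nbhs_ballP; exists (Num.min r r') => /=; first by rewrite lt_min r0.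
move=> z; rewrite /ball/= sub0r normrN lt_min => /andP[zr zr'] z0.
rewrite distrC /= /shift/= scaler1.
have -> : z^-1 *: (f (z + x) - f x) = (f (z + x) - f x) / (z + x - x).
  by rewrite addrK mulrC.
apply: hr; rewrite ?addrK//.
- by apply: hr'; rewrite /ball/= opprD addrCA subrr addr0 normrN.
- by rewrite -subr_eq0 addrK.
Qed.

Lemma mvt_on (a b u v : R) f : (forall x, `[a, b]%classic x -> derivable_on `[a, b] f x) ->
  a <= u -> u <= v -> v <= b ->
  exists2 x, u <= x <= v & f v - f u = derive_on `[a, b] f x * (v - u).
Proof.
move=> df au uv vb.
have [||x] := @MVT_segment R f (derive_on `[a, b] f) u v uv.
- move=> x; rewrite in_itv/= => /andP[ux xv]; apply: derivable_on_is_derive.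
    by apply: df; rewrite /= in_itv/=; apply/andP; split; lra.
  have : x \in `]a, b[ by rewrite in_itv/=; apply/andP; split; lra.
  by move=> /near_in_itvoo; apply: filterS => z /=; exact: subset_itv_oo_cc.
- apply: continuous_subspaceW (derivable_on_continuous df).
  by move=> z /=; rewrite !in_itv/= => /andP[? ?]; apply/andP; split; lra.
by rewrite in_itv/= => ? ?; exists x.
Qed.

End Calculus.

(** * The mixed derivative of the phase *)

(** One-sided difference quotients at the points of an interval have at most
    one limit. *)
Lemma itv_punctured_proper (R : realType) (a b z : R) : a < b -> `[a, b]%classic z ->
  ProperFilter (within `[a, b]%classic z^').
Proof.
move=> ab; rewrite /= in_itv/= => /andP[az zb]; apply: Build_ProperFilter_ex => P.
move=> /nbhs_ballP[r /= r0 hr].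
have [zm|zm] := leP z ((a + b) / 2).
  have m0 : 0 < Num.min r (b - a) / 2 by rewrite divr_gt0// lt_min r0 subr_gt0.
  have [m1 m2] : Num.min r (b - a) <= r /\ Num.min r (b - a) <= b - a.
    by rewrite !ge_min !lexx orbT.
  exists (z + Num.min r (b - a) / 2); apply: hr.
  - by rewrite /ball/= opprD addNKr normrN gtr0_norm//; lra.
  - by rewrite gt_eqF// ltrDl.
  - by rewrite /= in_itv/=; apply/andP; split; lra.
have m0 : 0 < Num.min r (b - a) / 2 by rewrite divr_gt0// lt_min r0 subr_gt0.
have [m1 m2] : Num.min r (b - a) <= r /\ Num.min r (b - a) <= b - a.
  by rewrite !ge_min !lexx orbT.
exists (z - Num.min r (b - a) / 2); apply: hr.
- by rewrite /ball/= opprB addrC subrK gtr0_norm//; lra.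
- by rewrite lt_eqF// gtrDl oppr_lt0.
- by rewrite /= in_itv/=; apply/andP; split; lra.
Qed.

Section Rectangle.
Variables (R : realType) (a b c d : R).
Hypotheses (ab : a < b) (cd : c < d).
Local Notation I0 := (`[a, b]%classic).
Local Notation J0 := (`[c, d]%classic).
Implicit Types (F Phi : R -> R -> R) (I J : R * R).

Let rect0 : (I0 `*` J0) !=set0.
Proof. by exists (a, c); split; rewrite /= in_itv/= lexx ltW. Qed.

Let rectK : compact (I0 `*` J0).
Proof. by apply: compact_setX; exact: segment_compact. Qed.

Lemma continuous_rect_bounded F : continuous_rect I0 J0 F ->
  exists2 M : R, 0 < M & forall x y, I0 x -> J0 y -> `|F x y| <= M.
Proof.
move=> cF; have [p1 _ h1] := compact_EVT_max rect0 rectK cF.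
have [p2 _ h2] := compact_EVT_min rect0 rectK cF.
exists (`|F p1.1 p1.2| + `|F p2.1 p2.2| + 1); first by rewrite ltr_wpDl// addr_ge0.
move=> x y Ix Jy; rewrite ler_norml.
have q : (x, y) \in I0 `*` J0 by rewrite inE.
have /= {}h1 := h1 _ q; have /= {}h2 := h2 _ q.
have := ler_norm (F p1.1 p1.2); have := ler_norm (- F p2.1 p2.2); rewrite normrN.
have := normr_ge0 (F p1.1 p1.2); have := normr_ge0 (F p2.1 p2.2).
by move=> *; apply/andP; split; lra.
Qed.

Lemma continuous_rect_away0 F : continuous_rect I0 J0 F ->
  (forall x y, I0 x -> J0 y -> F x y != 0) ->
  exists2 m : R, 0 < m & forall x y, I0 x -> J0 y -> m <= `|F x y|.
Proof.
move=> cF F0.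
have cN : {within I0 `*` J0, continuous (fun p : R * R => `|F p.1 p.2|)}.
  by move=> p; apply: (continuous_comp (cF p)); exact: norm_continuous.
have [p /[!inE] -[p1 p2] hp] := compact_EVT_min rect0 rectK cN.
exists `|F p.1 p.2|; first by rewrite normr_gt0 F0.
by move=> x y Ix Jy; apply: (hp (x, y)); rewrite inE.
Qed.

Lemma continuous_rect_uniform F (e : R) : continuous_rect I0 J0 F -> 0 < e ->
  exists2 r : R, 0 < r & forall x x' y y', I0 x -> I0 x' -> J0 y -> J0 y' ->
    `|x - x'| <= r -> `|y - y'| <= r -> `|F x y - F x' y'| < e.
Proof.
move=> cF e0.
pose P (r : R) (p : R * R) := forall x' y', I0 x' -> J0 y' ->
    `|p.1 - x'| <= r -> `|p.2 - y'| <= r -> `|F p.1 p.2 - F x' y'| < e.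
have near0 : nbhs (0 : R)^'+ [set r | I0 `*` J0 `<=` P r].
  have /near_covering_withinP cover := (compact_near_coveringP _).1 rectK.
  apply: (cover R (nbhs (0 : R)^'+) P _) => x [Ix Jx].
  have e2 : 0 < e / 2 by rewrite divr_gt0.
  have [r r0 hr] := continuous_rect_eps cF Ix Jx e2.
  exists (ball x (r / 2), [set z : R | z < r / 2]) => /=.
    split; first by apply: nbhsx_ballx; rewrite divr_gt0.
    by apply: nbhs_right_lt; rewrite divr_gt0.
  move=> [p z] /= [[b1 b2] zr] [Ip Jp] x' y' Ix' Jy' h1 h2.
  rewrite /ball/= in b1 b2.
  have k1 := hr p.1 p.2 Ip Jp ltac:(lra) ltac:(lra).
  have t1 := ler_distD p.1 x.1 x'; have t2 := ler_distD p.2 x.2 y'.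
  have k2 := hr x' y' Ix' Jy' ltac:(lra) ltac:(lra).
  have := ler_distD (F x.1 x.2) (F p.1 p.2) (F x' y').
  by rewrite (distrC (F p.1 p.2) (F x.1 x.2)); lra.
have [s [s0 hs]] := filter_ex (filterI (nbhs_right_gt (0 : R)) near0).
exists s => // x x' y y' Ix Ix' Jy Jy'; exact: (hs (x, y)).
Qed.

(** The mean value theorem, once in each variable.  The left-hand side is the
    change between [x'] and [x] of the relative phase of [y] and [y']. *)
Lemma mixed_difference Phi I J x x' y y' : C2_rect I0 J0 Phi ->
  a <= I.1 -> I.2 <= b -> c <= J.1 -> J.2 <= d ->
  x \in `[I.1, I.2] -> x' \in `[I.1, I.2] -> y \in `[J.1, J.2] -> y' \in `[J.1, J.2] ->
  exists u v, [/\ u \in `[I.1, I.2], v \in `[J.1, J.2] &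
    (Phi x y - Phi x y') - (Phi x' y - Phi x' y') =
    partial_y J0 (partial_x I0 Phi) u v * (x - x') * (y - y')].
Proof.
move=> [[dPhi _ _ _] [dPhix _ _ _] _] aI Ib cJ Jd.
have inI z : z \in `[I.1, I.2] -> I0 z.
  by rewrite !in_itv/= in_itv/= => /andP[? ?]; apply/andP; split; lra.
have inJ z : z \in `[J.1, J.2] -> J0 z.
  by rewrite !in_itv/= in_itv/= => /andP[? ?]; apply/andP; split; lra.
have half x1 x2 y1 y2 : x1 <= x2 -> y1 <= y2 ->
  x1 \in `[I.1, I.2] -> x2 \in `[I.1, I.2] -> y1 \in `[J.1, J.2] -> y2 \in `[J.1, J.2] ->
  exists u v, [/\ u \in `[I.1, I.2], v \in `[J.1, J.2] &
    (Phi x2 y2 - Phi x2 y1) - (Phi x1 y2 - Phi x1 y1) =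
    partial_y J0 (partial_x I0 Phi) u v * (x2 - x1) * (y2 - y1)].
  move=> x12 y12 xI1 xI2 yJ1 yJ2.
  pose D := fun t => Phi t y2 - Phi t y1.
  have dD z : I0 z -> derivable_on I0 D z /\
     derive_on I0 D z = partial_x I0 Phi z y2 - partial_x I0 Phi z y1.
    move=> Iz; have [d2 _] := dPhi z y2 Iz (inJ _ yJ2); have [d1 _] := dPhi z y1 Iz (inJ _ yJ1).
    have key : (D t - D z) / (t - z) @[t --> within I0 z^'] -->
       partial_x I0 Phi z y2 - partial_x I0 Phi z y1.
      have -> : (fun t => (D t - D z) / (t - z)) =
         (fun t => (Phi t y2 - Phi z y2) / (t - z) - (Phi t y1 - Phi z y1) / (t - z)).
        by apply/funext => t; rewrite /D -mulrBl; congr (_ / _); ring.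
      exact: cvgB.
    split; first exact: cvgP key.
    by have P0 := itv_punctured_proper ab Iz; apply/cvg_lim => //; exact: key.
  have dD1 z : I0 z -> derivable_on I0 D z by move=> /dD[].
  have [ax1 x2b] : a <= x1 /\ x2 <= b.
    by move: xI1 xI2; rewrite !in_itv/= => /andP[? ?] /andP[? ?]; split; lra.
  have [cy1 y2d] : c <= y1 /\ y2 <= d.
    by move: yJ1 yJ2; rewrite !in_itv/= => /andP[? ?] /andP[? ?]; split; lra.
  have [u u12 Du] := mvt_on dD1 ax1 x12 x2b.
  have uI : u \in `[I.1, I.2].
    by move: xI1 xI2 u12; rewrite !in_itv/= => /andP[? ?] /andP[? ?] /andP[? ?]; apply/andP; split; lra.
  have dp z : J0 z -> derivable_on J0 (partial_x I0 Phi u) z by move=> /(dPhix u z (inI u uI))[].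
  have [v v12 Dv] := mvt_on dp cy1 y12 y2d.
  exists u, v; split => //.
    by move: yJ1 yJ2 v12; rewrite !in_itv/= => /andP[? ?] /andP[? ?] /andP[? ?]; apply/andP; split; lra.
  rewrite -/(D x2) -/(D x1) Du (dD u (inI u uI)).2 Dv /partial_y; ring.
move=> xI xI' yJ yJ'.
have [x12|/ltW x12] := leP x' x; have [y12|/ltW y12] := leP y' y.
- have [u [v [uI vJ E]]] := half _ _ _ _ x12 y12 xI' xI yJ' yJ.
  by exists u, v; split => //; lra.
- have [u [v [uI vJ E]]] := half _ _ _ _ x12 y12 xI' xI yJ yJ'.
  by exists u, v; split => //; lra.
- have [u [v [uI vJ E]]] := half _ _ _ _ x12 y12 xI xI' yJ' yJ.
  by exists u, v; split => //; lra.
- have [u [v [uI vJ E]]] := half _ _ _ _ x12 y12 xI xI' yJ yJ'.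
  by exists u, v; split => //; lra.
Qed.

End Rectangle.

(** Up to a factor of two, the mixed derivative of the phase has the constant
    size [k] on [I * J]. *)
Definition twist (R : realType) (Phi : R -> R -> R) (k : R) (I J : R * R) :=
  forall x x' y y', x \in `[I.1, I.2] -> x' \in `[I.1, I.2] ->
    y \in `[J.1, J.2] -> y' \in `[J.1, J.2] ->
    k * `|x - x'| * `|y - y'| <= `|(Phi x y - Phi x y') - (Phi x' y - Phi x' y')|
      <= 2 * k * `|x - x'| * `|y - y'|.

Section LocalTwist.
Variables (R : realType) (a b c d : R).
Hypotheses (ab : a < b) (cd : c < d).
Local Notation I0 := (`[a, b]%classic).
Local Notation J0 := (`[c, d]%classic).
Implicit Types (F Phi : R -> R -> R) (I J : R * R).

(** The mixed derivative is uniformly continuous and bounded away from [0], so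
    its relative variation is small on products of short intervals. *)
Lemma local_twist Phi : C2_rect I0 J0 Phi ->
  (forall x y, I0 x -> J0 y -> partial_y J0 (partial_x I0 Phi) x y != 0) ->
  exists r m M : R, [/\ 0 < r, 0 < m, 0 < M &
    forall I J, a <= I.1 -> I.1 <= I.2 -> I.2 <= b -> c <= J.1 -> J.1 <= J.2 -> J.2 <= d ->
      I.2 - I.1 <= r -> J.2 - J.1 <= r ->
      exists2 k, m <= k <= M & twist Phi k I J].
Proof.
move=> C2 nz; set p := partial_y J0 (partial_x I0 Phi).
have cp : continuous_rect I0 J0 p by case: C2 => _ [].
have [m m0 hm] := continuous_rect_away0 ab cd cp nz.
have [M M0 hM] := continuous_rect_bounded ab cd cp.
have m3 : 0 < m / 3 by rewrite divr_gt0.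
have [r r0 hr] := continuous_rect_uniform cp m3.
exists r, (2 / 3 * m), M; split => //; first by rewrite mulr_gt0.
move=> I J aI I12 Ib cJ J12 Jd Ir Jr.
have I1 : I0 I.1 by rewrite /= in_itv/=; apply/andP; split; lra.
have J1 : J0 J.1 by rewrite /= in_itv/=; apply/andP; split; lra.
have h1 := hm _ _ I1 J1; have h2 := hM _ _ I1 J1.
exists (2 / 3 * `|p I.1 J.1|); first by apply/andP; split; lra.
move=> x x' y y' xI xI' yJ yJ'.
have [u [v [uI vJ ->]]] := mixed_difference ab C2 aI Ib cJ Jd xI xI' yJ yJ'.
rewrite -/p !normrM.
have close : `|p I.1 J.1 - p u v| < m / 3.
  move: uI vJ; rewrite !in_itv/= => /andP[? ?] /andP[? ?].
  by apply: hr => //; rewrite /= ?in_itv/= ?ler_norml; apply/andP; split; lra.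
have k1 : `|p u v| <= 4 / 3 * `|p I.1 J.1|.
  by have := ler_normB (p I.1 J.1) (p I.1 J.1 - p u v); rewrite opprB addrC subrK; lra.
have k2 : 2 / 3 * `|p I.1 J.1| <= `|p u v|.
  by have := ler_normD (p I.1 J.1 - p u v) (p u v); rewrite subrK; lra.
have e0 : 0 <= `|x - x'| * `|y - y'| by rewrite mulr_ge0.
by rewrite -!mulrA; apply/andP; split; rewrite ?mulrA -2?(mulrA _ `|x - x'|) ler_wpM2r//; lra.
Qed.

End LocalTwist.

(** * Integrals of complex functions *)

Section ComplexIntegral.
Variable R : realType.
Variable mu : {finite_measure set (measurableTypeR R) -> \bar R}.
Implicit Types (A B : set (measurableTypeR R)) (f g : R -> R[i]) (n : R -> R).

Definition integrableC A f :=
  mu.-integrable A (fun t => (complex.Re (f t))%:E) /\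
  mu.-integrable A (fun t => (complex.Im (f t))%:E).

Lemma integrableCS A B f : measurable A -> measurable B -> B `<=` A ->
  integrableC A f -> integrableC B f.
Proof. by move=> mA mB BA [h1 h2]; split; apply: integrableS BA _. Qed.

Lemma integralC_setU A B f : measurable A -> measurable B -> A `&` B = set0 ->
  integrableC (A `|` B) f ->
  integralC mu (A `|` B) f = integralC mu A f + integralC mu B f.
Proof.
move=> mA mB AB [h1 h2]; have dAB : [disjoint A & B] by apply/disj_set2P.
by rewrite /integralC !Rintegral_setU.
Qed.

Lemma integralC_set0 f : integralC mu set0 f = 0.
Proof. by rewrite /integralC !Rintegral_set0. Qed.

Lemma integralCZ A (c : R[i]) f : measurable A -> integrableC A f ->
  integralC mu A (fun t => c * f t) = c * integralC mu A f.
Proof.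
move=> mA [h1 h2]; rewrite /integralC.
have Z (r : R) (u : R -> R) : mu.-integrable A (fun t => (u t)%:E) ->
    mu.-integrable A (fun t => (r * u t)%:E).
  by move=> hu; apply: (eq_integrable mA _ _ _ (integrableZl mA r hu)) => t _; rewrite EFinM.
have -> : Rintegral mu A (fun t => complex.Re (c * f t)) =
    complex.Re c * Rintegral mu A (fun t => complex.Re (f t)) -
    complex.Im c * Rintegral mu A (fun t => complex.Im (f t)).
  rewrite -!RintegralZl// -RintegralB//; [|exact: Z..].
  by apply: eq_Rintegral => t _; case: c (f t) => ? ? [].
have -> : Rintegral mu A (fun t => complex.Im (c * f t)) =
    complex.Re c * Rintegral mu A (fun t => complex.Im (f t)) +
    complex.Im c * Rintegral mu A (fun t => complex.Re (f t)).
  rewrite -!RintegralZl// -RintegralD//; [|exact: Z..].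
  by apply: eq_Rintegral => t _; case: c (f t) => ? ? [].
by case: c.
Qed.

Lemma integralCB A f g : measurable A -> integrableC A f -> integrableC A g ->
  integralC mu A (fun t => f t - g t) = integralC mu A f - integralC mu A g.
Proof.
move=> mA [f1 f2] [g1 g2]; rewrite /integralC.
have -> : Rintegral mu A (fun t => complex.Re (f t - g t)) =
  Rintegral mu A (fun t => complex.Re (f t)) - Rintegral mu A (fun t => complex.Re (g t)).
  by rewrite -RintegralB//; apply: eq_Rintegral => t _; rewrite raddfB.
have -> // : Rintegral mu A (fun t => complex.Im (f t - g t)) =
  Rintegral mu A (fun t => complex.Im (f t)) - Rintegral mu A (fun t => complex.Im (g t)).
by rewrite -RintegralB//; apply: eq_Rintegral => t _; rewrite raddfB.
Qed.

Lemma integrableCZ A (c : R[i]) f : measurable A -> integrableC A f ->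
  integrableC A (fun t => c * f t).
Proof.
move=> mA [h1 h2]; split.
- apply: (eq_integrable mA _ _ _ (integrableB mA (integrableZl mA (complex.Re c) h1)
    (integrableZl mA (complex.Im c) h2))) => t _.
  by case: c (f t) => ? ? [].
- apply: (eq_integrable mA _ _ _ (integrableD mA (integrableZl mA (complex.Re c) h2)
    (integrableZl mA (complex.Im c) h1))) => t _.
  by case: c (f t) => ? ? [].
Qed.

Lemma integrableCB A f g : measurable A -> integrableC A f -> integrableC A g ->
  integrableC A (fun t => f t - g t).
Proof.
move=> mA [f1 f2] [g1 g2]; split.
- apply: (eq_integrable mA _ _ _ (integrableB mA f1 g1)) => t _.
  by case: (f t) (g t) => ? ? [].
- apply: (eq_integrable mA _ _ _ (integrableB mA f2 g2)) => t _.
  by case: (f t) (g t) => ? ? [].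
Qed.

Lemma normc_ge_Re_Im (z : R[i]) : `|complex.Re z| <= normc z /\ `|complex.Im z| <= normc z.
Proof.
split; rewrite -ler_sqr ?nnegrE ?normc_ge0// normc_sqr real_normK ?num_real//.
  by rewrite lerDl sqr_ge0.
by rewrite lerDr sqr_ge0.
Qed.

Lemma normc_le_Re_Im (z : R[i]) : normc z <= `|complex.Re z| + `|complex.Im z|.
Proof.
rewrite -ler_sqr ?nnegrE ?normc_ge0 ?addr_ge0// normc_sqr.
rewrite -(real_normK (num_real (complex.Re z))) -(real_normK (num_real (complex.Im z))).
have := normr_ge0 (complex.Re z); have := normr_ge0 (complex.Im z); nra.
Qed.

(** Bounding both components separately loses a factor of two, which only
    enters the final constant: this bound is never iterated over scales. *)
Lemma normc_integralC A f n (k : R) : measurable A -> integrableC A f ->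
  mu.-integrable A (EFin \o n) -> (forall t, A t -> normc (f t) <= k * n t) ->
  normc (integralC mu A f) <= 2 * k * Rintegral mu A n.
Proof.
move=> mA [f1 f2] hn fn; rewrite (le_trans (normc_le_Re_Im _))//=.
have hk : mu.-integrable A (EFin \o (fun t => k * n t)).
  by apply: (eq_integrable mA _ _ _ (integrableZl mA k hn)) => t _; rewrite /= EFinM.
have half (u : R -> R) : mu.-integrable A (EFin \o u) ->
    (forall t, A t -> `|u t| <= k * n t) -> `|Rintegral mu A u| <= k * Rintegral mu A n.
  move=> hu un; rewrite (le_trans (le_normr_Rintegral mA hu))// -RintegralZl//.
  apply: le_Rintegral => //.
  exact: (integrable_abse hu).
have := half _ f1 (fun t At => le_trans (normc_ge_Re_Im _).1 (fn t At)).
have := half _ f2 (fun t At => le_trans (normc_ge_Re_Im _).2 (fn t At)).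
lra.
Qed.

Lemma measurable_normc A f :
  measurable_fun A (fun t : measurableTypeR R => complex.Re (f t)) ->
  measurable_fun A (fun t : measurableTypeR R => complex.Im (f t)) ->
  measurable_fun A (fun t : measurableTypeR R => normc (f t)).
Proof.
move=> m1 m2.
have -> : (fun t => normc (f t)) =
    (fun t => Num.sqrt (complex.Re (f t) ^+ 2 + complex.Im (f t) ^+ 2)).
  by apply/funext => t; case: (f t).
apply: (@measurableT_comp _ _ _ _ _ _ (@Num.sqrt R)).
  by apply: continuous_measurable_fun; exact: sqrt_continuous.
by apply: measurable_funD; exact: measurable_funX.
Qed.

(** A square-integrable function is integrable, since the measure is finite. *)
Lemma inL2_integrable A f : measurable A -> inL2 mu A f -> (normL2 mu A f <= 1)%E ->
  [/\ mu.-integrable A (EFin \o (fun t => normc (f t))),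
      mu.-integrable A (EFin \o (fun t => normc (f t) ^+ 2)) &
      Rintegral mu A (fun t => normc (f t) ^+ 2) <= 1].
Proof.
move=> mA [m1 m2 _] f1; have mn := measurable_normc m1 m2.
have mn2 : measurable_fun A (EFin \o (fun t : measurableTypeR R => normc (f t) ^+ 2)).
  by apply/measurable_EFinP; exact: measurable_funX.
have E : (\int[mu]_(t in A) (normc (f t) ^+ 2)%:E <= 1)%E.
  have -> : (\int[mu]_(t in A) (normc (f t) ^+ 2)%:E = normL2 mu A f `^ 2)%E.
    rewrite /normL2 powR_Lnorm// [LHS]integral_mkcond; apply: eq_integral => t _.
    rewrite /= !patchE; case: ifP => _; last by rewrite -[X in `|X|]/(0 : R) normr0 powR0.
    by rewrite ger0_norm ?normc_ge0// powR_mulrn// normc_ge0.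
  rewrite -[leRHS](@poweR1r _ 2); apply: gt0_ler_poweR => //.
  - by rewrite in_itv/= Lnorm_ge0 leey.
  - by rewrite in_itv/= lee01 leey.
have i2 : mu.-integrable A (EFin \o (fun t => normc (f t) ^+ 2)).
  apply/integrableP; split => //.
  under eq_integral => t _ do rewrite /= ger0_norm ?sqr_ge0//.
  exact: le_lt_trans E (ltry _).
split => //.
  apply: (@le_integrable _ _ _ mu A mA _ (EFin \o (fun t => 1 + normc (f t) ^+ 2))).
  - exact/measurable_EFinP.
  - move=> t At; rewrite /= lee_fin !ger0_norm ?addr_ge0 ?sqr_ge0 ?normc_ge0//.
    by have := sqr_ge0 (normc (f t) - 1); have := normc_ge0 (f t); nra.
  - have i1 : mu.-integrable A (EFin \o (fun=> 1)).
      by apply: finite_measure_integrable_cst.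
    exact: (eq_integrable mA _ _ _ (integrableD mA i1 i2)).
rewrite -lee_fin /Rintegral fineK// ge0_fin_numE.
  exact: le_lt_trans E (ltry _).
by apply: integral_ge0 => t _; rewrite lee_fin sqr_ge0.
Qed.

End ComplexIntegral.

(** * One step of the contraction *)

Definition subitv (R : realType) (I J : R * R) := J.1 <= I.1 /\ I.2 <= J.2.

Section SupLipNorm.
Variable R : realType.
Implicit Types (F : R -> R[i]) (w N : R) (I J : R * R).

Lemma subitv_in I J x : subitv I J -> x \in `[I.1, I.2] -> x \in `[J.1, J.2].
Proof.
by move=> [? ?]; rewrite !in_itv/= => /andP[? ?]; apply/andP; split; lra.
Qed.

Definition sup_lip_norm F w I : R := inf [set N | sup_lip_bound F w I N].

Lemma sup_lip_normP F w I : (exists N, sup_lip_bound F w I N) ->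
  sup_lip_bound F w I (sup_lip_norm F w I).
Proof.
move=> ne; split.
- by apply: lb_le_inf => // N [].
- by move=> x xI; apply: lb_le_inf => // N [_ + _]; exact.
- move=> x x' xI xI'; have [->|xx'] := eqVneq x x'.
    by rewrite !subrr Normc.normc0 normr0 !mulr0.
  have xx0 : 0 < `|x - x'| by rewrite normr_gt0 subr_eq0.
  rewrite -ler_pdivrMr//; apply: lb_le_inf => // N [_ _ h].
  by rewrite ler_pdivrMr// h.
Qed.

Lemma sup_lip_norm_le F w I N : sup_lip_bound F w I N -> sup_lip_norm F w I <= N.
Proof. by move=> h; apply: ge_inf => //; exists 0 => ? []. Qed.

Lemma sup_lip_norm_ge0 F w I : (exists N, sup_lip_bound F w I N) -> 0 <= sup_lip_norm F w I.
Proof. by move=> /sup_lip_normP[]. Qed.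

Lemma sup_lip_boundS F w I J N : subitv I J -> sup_lip_bound F w J N -> sup_lip_bound F w I N.
Proof.
move=> IJ [h0 h1 h2]; split => // [x /(subitv_in IJ)|x x' /(subitv_in IJ) ? /(subitv_in IJ) ?].
  exact: h1.
exact: h2.
Qed.

End SupLipNorm.

(** In a cell of length [A ^ 2 * e'] the phases vary with Lipschitz constant
    [2 * k * A ^ 2 * e' / h].  The weight [e / (8 * A ^ 2)] makes this harmless
    after one division of the scale.  The ratio [A ^ 11] leaves room, between
    the scale of a cell and that of its pieces, for distances comparable to
    [A ^- 8] times the scale, up to factors [A ^ 2] on both sides. *)
Section Contraction.
Variables (R : realType) (A h k : R) (X Y : set R).
Variables muX muY : {finite_measure set (measurableTypeR R) -> \bar R}.
Variables (Phi : R -> R -> R) (F : R * R -> R -> R[i]) (It Jt : R * R).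
Hypotheses (h_gt0 : 0 < h) (k_gt0 : 0 < k) (A_large : 200 <= A).
Hypotheses (MX : multiscale A h X muX) (MY : multiscale A h Y muY).
Hypothesis Phi_twist : twist Phi k It Jt.
Hypothesis F_bounded : forall J w, 0 < w -> subitv J Jt -> exists N, sup_lip_bound (F J) w It N.
Hypothesis F_split : forall J s x, subitv J Jt -> splits Y J s -> 0 < mass muY J ->
  (forall J', J' \in s -> 0 < mass muY J') -> x \in `[It.1, It.2] ->
  F J x = \sum_(J' <- s) (mass muY J' / mass muY J)%:C *
             (expi ((Phi x J'.1 - Phi x J.1) / h) * F J' x).

Local Notation L := (A ^+ 11).
Local Notation weight e := (e / (8 * A ^+ 2)).

Let A0 : 0 < A. Proof. by apply: lt_le_trans A_large; rewrite ltr0n. Qed.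
Let L0 : 0 < L. Proof. by rewrite exprn_gt0. Qed.

(** Two points of the set at a distance comparable to [A ^- 8 * e] may be moved
    freely inside the pieces that contain them, since the pieces have the much
    smaller length [A ^- 9 * e]. *)
Lemma far_pieces (Z : set R) mu (e : R) I s : multiscale A h Z mu ->
  h <= e / L -> e <= 1 -> cell Z e I -> splits Z I s ->
  (forall J, J \in s -> cell Z (e / L) J) ->
  exists J J', [/\ J \in s, J' \in s &
    forall x x', x \in `[J.1, J.2] -> x' \in `[J'.1, J'.2] ->
    (A ^- 8 - 2 * A ^- 9) * e <= `|x - x'| <= (A ^- 6 + 2 * A ^- 9) * e].
Proof.
move=> [_ _ [len _ _ pts]] hL e1 cI sp cs.
have e0 : 0 < e by rewrite -(pmulr_lgt0 (x := L^-1)) ?invr_gt0// (lt_le_trans h_gt0).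
have A01 := A_large; have A00 := A0; have L00 := L0.
have L1 : h <= A ^- 8 * e.
  rewrite (le_trans hL)// mulrC ler_pM2r// lef_pV2 ?posrE ?exprn_gt0//.
  by rewrite ler_weXn2l//; lra.
have r1 : A ^+ 2 * A ^- 8 <= 1 / 2.
  have -> : A ^+ 2 * A ^- 8 = (A ^+ 6)^-1 by field; rewrite gt_eqF.
  rewrite div1r lef_pV2 ?posrE ?exprn_gt0//.
  by rewrite (@le_trans _ _ A)//; [lra|rewrite ler_eXnr//; lra].
have r0 : 0 < A ^- 8 by rewrite invr_gt0 exprn_gt0.
have [|x [x' [Zx Zx' xI xI' /andP[d1 d2]]]] := pts e (A ^- 8) I L1 _ r0 r1 cI.
  by rewrite e0.
have [J Js xJ] := splits_cover sp Zx xI; have [J' Js' xJ'] := splits_cover sp Zx' xI'.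
exists J, J'; split => // z z' zJ zJ'.
have heL : h <= e / L <= 1.
  rewrite hL/= ler_pdivrMr// mul1r (le_trans e1)// exprn_ege1//; lra.
have l1 := len _ _ heL (cs _ Js); have l2 := len _ _ heL (cs _ Js').
have E : A ^+ 2 * (e / L) = A ^- 9 * e by field; rewrite gt_eqF.
rewrite {}E in l1 l2.
have E : A ^+ 2 * A ^- 8 = A ^- 6 by field; rewrite gt_eqF.
rewrite {}E in d2.
have dz y y' K : y \in `[K.1, K.2] -> y' \in `[K.1, K.2] -> K.2 - K.1 <= A ^- 9 * e ->
    `|y - y'| <= A ^- 9 * e.
  by rewrite !in_itv/= => /andP[? ?] /andP[? ?] ?; rewrite ler_norml; apply/andP; split; lra.
have m1 := dz _ _ _ xJ zJ l1; have m2 := dz _ _ _ xJ' zJ' l2.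
move: m1 m2 d1 d2; set p := A ^- 9 * e => m1 m2 d1 d2.
have -> : (A ^- 8 - 2 * A ^- 9) * e = A ^- 8 * e - 2 * p by rewrite /p; ring.
have -> : (A ^- 6 + 2 * A ^- 9) * e = A ^- 6 * e + 2 * p by rewrite /p; ring.
have t1 := ler_distD z x x'; have t2 := ler_distD z' z x'.
have t3 := ler_distD x z z'; have t4 := ler_distD x' x z'.
rewrite (distrC z x) (distrC z' x') in t1 t2 t3 t4.
by apply/andP; split; lra.
Qed.


(** The arithmetic of the exponents.  The relative distances of [far_pieces]
    lie between [A ^- 8 - 2 * A ^- 9] and [A ^- 6 + 2 * A ^- 9]: small enough
    for phases to turn by at most [1], and large enough for this turn to beat
    both the Lipschitz variation and the defect [A ^- 6] of alignment. *)
Lemma pow_inv_bounds : [/\ 8 * A ^- 6 <= (A ^- 8 - 2 * A ^- 9) * A ^+ 2 * (A / 4 - 21),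
   0 <= A ^- 8 - 2 * A ^- 9, (A ^- 8 - 2 * A ^- 9) * L = A ^+ 3 - 2 * A ^+ 2 &
   2 * ((A ^- 6 + 2 * A ^- 9) ^+ 2 * L) <= 1].
Proof.
have A00 := A0; have A01 := A_large; have An0 : A != 0 by rewrite gt_eqF.
have inv0 n : 0 < A ^- n by rewrite invr_gt0 exprn_gt0.
have i6 := inv0 6%N; have i9 := inv0 9%N; have i1 := inv0 1%N.
have E8 : A ^- 8 = A * A ^- 9 by field.
have E6 : A ^- 6 = A ^+ 3 * A ^- 9 by field.
split.
- rewrite E8 E6.
  have -> : (A * A ^- 9 - 2 * A ^- 9) * A ^+ 2 * (A / 4 - 21) =
     A ^+ 2 * ((A - 2) * (A / 4 - 21)) * A ^- 9 by ring.
  rewrite [leLHS]mulrA ler_pM2r//.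
  have -> : 8 * A ^+ 3 = A ^+ 2 * (8 * A) by ring.
  by rewrite ler_wpM2l ?exprn_ge0 ?(ltW A00)//; nra.
- by rewrite E8; nra.
- by field.
- have -> : (A ^- 6 + 2 * A ^- 9) ^+ 2 * L = A^-1 * (1 + 2 * A ^- 3) ^+ 2 by field.
  have i3 := inv0 3%N.
  have i31 : A ^- 3 <= 1.
    by rewrite invf_le1 ?exprn_gt0// exprn_ege1//; lra.
  have i : A^-1 <= 1 / 200 by rewrite div1r lef_pV2 ?posrE//; lra.
  have : (1 + 2 * A ^- 3) ^+ 2 <= 9 by nra.
  have : 0 <= (1 + 2 * A ^- 3) ^+ 2 by rewrite sqr_ge0.
  have : 0 < A^-1 by rewrite invr_gt0.
  set u := (1 + 2 * A ^- 3) ^+ 2; nra.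
Qed.

Section OneStep.
Variables (e e' : R) (I J : R * R) (sI sJ : seq (R * R)).
Hypotheses (II : subitv I It) (JJ : subitv J Jt).
Hypotheses (cI : cell X e I) (cJ : cell Y e' J) (e_le1 : e <= 1) (e'_le1 : e' <= 1).
Hypotheses (he : h <= e / L) (he' : h <= e' / L) (balance : e * e' * k = h * L).
Hypotheses (spI : splits X I sI) (csI : forall I', I' \in sI -> cell X (e / L) I').
Hypotheses (spJ : splits Y J sJ) (csJ : forall J', J' \in sJ -> cell Y (e' / L) J').

Let scale_pos z : h <= z / L -> 0 < z.
Proof. by move=> hz; rewrite -(pmulr_lgt0 (x := L^-1)) ?invr_gt0// (lt_le_trans h_gt0). Qed.
Let e0 : 0 < e. Proof. exact: scale_pos. Qed.
Let e'0 : 0 < e'. Proof. exact: scale_pos. Qed.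
Let L1 : 1 <= L.
Proof. by rewrite exprn_ege1// (le_trans _ A_large)// ler1n. Qed.
Let shrink z : 0 < z -> z / L <= z.
Proof. by move=> z0; rewrite ler_pdivrMr// ler_peMr// ltW. Qed.

Let w := weight e.
Let w0 : 0 < w.
Proof. by rewrite divr_gt0// mulr_gt0// exprn_gt0. Qed.

Let p (J' : R * R) := mass muY J' / mass muY J.
Let psi (J' : R * R) (x : R) := (Phi x J'.1 - Phi x J.1) / h.
Let N (J' : R * R) := sup_lip_norm (F J') w I.
Let Vsq := \sum_(J' <- sJ) p J' * N J' ^+ 2.
Let S := \sum_(J' <- sJ) p J' * N J'.

Let mJ : 0 < mass muY J.
Proof.
case: MY => _ _ [_ pos _ _]; apply: (pos e') => //.
by rewrite e'_le1 andbT (le_trans he')// shrink.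
Qed.

Let mJ' J' : J' \in sJ -> 0 < mass muY J'.
Proof.
move=> Js; case: MY => _ _ [_ pos _ _]; apply: (pos (e' / L)); last exact: csJ.
by rewrite he' (le_trans (shrink e'0)).
Qed.

Let p_ge0 J' : 0 <= p J'.
Proof. by rewrite divr_ge0// mass_ge0. Qed.

Let p_sum1 : \sum_(J' <- sJ) p J' = 1.
Proof.
case: MY => mY nY _.
by rewrite -mulr_suml -(mass_splits mY nY spJ) divff// gt_eqF.
Qed.

Let subJ' J' : J' \in sJ -> subitv J' Jt.
Proof. by move=> /(splits_sub spJ)[? ?]; case: JJ => ? ?; split; lra. Qed.

Let NP J' : J' \in sJ -> sup_lip_bound (F J') w I (N J').
Proof.
move=> /subJ' sub'; apply: sup_lip_normP.
have [M hM] := F_bounded w0 sub'; exists M; exact: sup_lip_boundS hM.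
Qed.

Let FE x : x \in `[I.1, I.2] ->
  F J x = \sum_(J' <- sJ) (p J')%:C * (expi (psi J' x) * F J' x).
Proof. by move=> xI; rewrite (F_split JJ spJ)//; exact: subitv_in xI. Qed.

Let left_in J' : J' \in sJ -> J'.1 \in `[Jt.1, Jt.2].
Proof.
move=> Js; apply: subitv_in (subJ' Js) _; rewrite in_itv/= lexx.
by have [] := csJ Js.
Qed.

Let left_inJ : J.1 \in `[Jt.1, Jt.2].
Proof. by apply: subitv_in JJ _; rewrite in_itv/= lexx; case: cJ. Qed.

Let psi_lip J' x x' : J' \in sJ -> x \in `[I.1, I.2] -> x' \in `[I.1, I.2] ->
  `|psi J' x - psi J' x'| <= 2 * k * (A ^+ 2 * e') / h * `|x - x'|.
Proof.
move=> Js xI xI'.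
have /andP[_ tw] := Phi_twist (subitv_in II xI) (subitv_in II xI') (left_in Js) left_inJ.
have len : `|J'.1 - J.1| <= A ^+ 2 * e'.
  case: MY => _ _ [len _ _ _].
  have h1 := len e' J; rewrite e'_le1 andbT in h1.
  have {}h1 := h1 (le_trans he' (shrink e'0)) cJ.
  have [j1 j2] := splits_sub spJ Js; have [j3 _ _ _] := csJ Js.
  by rewrite ger0_norm; lra.
rewrite /psi -mulrBl normrM (@ger0_norm _ h^-1) ?invr_ge0 ?(ltW h_gt0)//.
rewrite ler_pdivrMr// (le_trans tw)//.
have -> : 2 * k * (A ^+ 2 * e') / h * `|x - x'| * h = 2 * k * `|x - x'| * (A ^+ 2 * e').
  by field; rewrite gt_eqF.
by rewrite ler_wpM2l// !mulr_ge0// ltW.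
Qed.

Let S0 : 0 <= S.
Proof. by rewrite /S big_seq sumr_ge0// => J' /NP[? _ _]; rewrite mulr_ge0. Qed.

Let SV : S ^+ 2 <= Vsq.
Proof. exact: sqr_mean_le. Qed.

(** On a smaller interval the Lipschitz part of the norm contracts by itself:
    the twisting phases vary only by a bounded amount on the pieces of [I]. *)
Let lip_half I' x x' : I' \in sI -> x \in `[I'.1, I'.2] -> x' \in `[I'.1, I'.2] ->
  weight (e / L) * normc (F J x - F J x') <= S / 2 * `|x - x'|.
Proof.
move=> Is xI xI'.
have inI z : z \in `[I'.1, I'.2] -> z \in `[I.1, I.2].
  exact: (subitv_in (splits_sub spI Is)).
have := twisted_mean_lip p_ge0 w0 NP (fun J' Js => psi_lip Js (inI _ xI) (inI _ xI'))
  (inI _ xI) (inI _ xI').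
rewrite -!FE ?inI//; fold S => step.
have -> : weight (e / L) = w / L by rewrite /w mulrAC.
have wl : w * (2 * k * (A ^+ 2 * e') / h) = L / 4.
  have -> : w * (2 * k * (A ^+ 2 * e') / h) = (e * e' * k) / (4 * h).
    by rewrite /w; field; rewrite !gt_eqF.
  by rewrite balance; field; rewrite gt_eqF.
rewrite {}wl in step.
rewrite mulrAC ler_pdivrMr// (le_trans step)//.
have -> : S / 2 * `|x - x'| * L = S * `|x - x'| * (L / 2) by ring.
have -> : (1 + L / 4) * S * `|x - x'| = S * `|x - x'| * (1 + L / 4) by ring.
rewrite ler_wpM2l ?mulr_ge0//.
have : 4 <= L.
  rewrite (@le_trans _ _ A)//; last by rewrite ler_eXnr// (le_trans _ A_large)// ler1n.
  by rewrite (le_trans _ A_large)// ler_nat.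
lra.
Qed.

Let sup_S I' x : I' \in sI -> x \in `[I'.1, I'.2] -> normc (F J x) <= S.
Proof.
move=> Is xI; have xI1 := subitv_in (splits_sub spI Is) xI.
by rewrite FE//; exact: (twisted_mean_le p_ge0 psi NP).
Qed.

Let norm_all I' : I' \in sI -> sup_lip_norm (F J) (weight (e / L)) I' ^+ 2 <= Vsq.
Proof.
move=> Is; apply: le_trans SV.
have b : sup_lip_bound (F J) (weight (e / L)) I' S.
  split => // [x|x x' xI xI']; first exact: sup_S.
  by rewrite (le_trans (lip_half Is xI xI'))// ler_wpM2r//; have := S0; lra.
have n0 := sup_lip_norm_ge0 (ex_intro _ _ b).
by rewrite ler_sqr ?nnegrE// sup_lip_norm_le.
Qed.

Let gamma : R := A ^- 14 * (A ^- 6) ^+ 2.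

Let gamma_small : 0 < gamma <= 1 / 2.
Proof.
have A00 := A0; have A01 := A_large.
have i1 n : 0 < A ^- n.+1 <= 1 / 2.
  rewrite invr_gt0 exprn_gt0//= div1r lef_pV2 ?posrE ?exprn_gt0//.
  by rewrite (@le_trans _ _ A)//; [lra|rewrite ler_eXnr//; lra].
rewrite /gamma; have /andP[a1 a2] := i1 13%N; have /andP[b1 b2] := i1 5%N.
rewrite mulr_gt0 ?exprn_gt0//=.
have : (A ^- 6) ^+ 2 <= 1 by rewrite expr_le1//; lra.
move: a1 a2; set u := A ^- 14; set v := _ ^+ 2.
have : 0 <= v by rewrite sqr_ge0.
nra.
Qed.

Let weight_lower (Z : set R) mu z (K K' : R * R) : multiscale A h Z mu -> h <= z / L -> z <= 1 ->
  cell Z z K -> cell Z (z / L) K' -> A ^- 14 * mass mu K <= mass mu K'.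
Proof.
move=> [_ _ [_ _ ratio _]] hz z1 cK cK'; have z0 := scale_pos hz.
have := ratio z (z / L) K K'; rewrite hz shrink// => /(_ isT z1 cK cK').
have -> : z / L / z = L^-1 by field; rewrite !gt_eqF.
rewrite mulrC -ler_pdivrMl ?exprn_gt0// => m; apply: le_trans m.
by rewrite le_eqVlt; apply/orP; left; apply/eqP; field; rewrite gt_eqF.
Qed.

(** Two pairs of separated pieces, in [I] and in [J], make the phases turn:
    somewhere the sup part of the norm contracts as well. *)
Let norm_gain : exists2 I', I' \in sI &
  sup_lip_norm (F J) (weight (e / L)) I' ^+ 2 <= (1 - gamma) * Vsq.
Proof.
have [Ia [Ib [Ias Ibs farI]]] := far_pieces MX he e_le1 cI spI csI.
have [Ja [Jb [Jas Jbs farJ]]] := far_pieces MY he' e'_le1 cJ spJ csJ.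
have /andP[g0 g1] := gamma_small.
have V0 : 0 <= Vsq by rewrite (le_trans _ SV)// sqr_ge0.
have conclude I' : I' \in sI ->
    (forall x, x \in `[I'.1, I'.2] -> normc (F J x) ^+ 2 <= (1 - gamma) * Vsq) ->
    sup_lip_norm (F J) (weight (e / L)) I' ^+ 2 <= (1 - gamma) * Vsq.
  move=> Is small.
  have q0 : 0 <= (1 - gamma) * Vsq by rewrite mulr_ge0//; lra.
  pose M := Num.sqrt ((1 - gamma) * Vsq).
  have M0 : 0 <= M by exact: sqrtr_ge0.
  have M2 : M ^+ 2 = (1 - gamma) * Vsq by rewrite sqr_sqrtr.
  have b : sup_lip_bound (F J) (weight (e / L)) I' M.
    split => // [x xI|x x' xI xI'].
      by rewrite -ler_sqr ?nnegrE ?normc_ge0// M2 small.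
    rewrite (le_trans (lip_half Is xI xI'))// ler_wpM2r//.
    have Sh : 0 <= S / 2 by rewrite divr_ge0// S0.
    rewrite -ler_sqr ?nnegrE// M2; have := SV; nra.
  have n0 := sup_lip_norm_ge0 (ex_intro _ _ b).
  by rewrite -M2 ler_sqr ?nnegrE// sup_lip_norm_le.
have [Pa|/existsNP[x /not_implyP[xI /negP]]] :=
    pselect (forall x, x \in `[Ia.1, Ia.2] -> normc (F J x) ^+ 2 <= (1 - gamma) * Vsq).
  by exists Ia => //; exact: conclude.
rewrite -ltNge => hx.
have [Pb|/existsNP[x' /not_implyP[xI' /negP]]] :=
    pselect (forall x, x \in `[Ib.1, Ib.2] -> normc (F J x) ^+ 2 <= (1 - gamma) * Vsq).
  by exists Ib => //; exact: conclude.
rewrite -ltNge => hx'; exfalso.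
have xI1 := subitv_in (splits_sub spI Ias) xI.
have xI1' := subitv_in (splits_sub spI Ibs) xI'.
have [P1 P2 P3 P4] := pow_inv_bounds.
have A00 := A0; have A01 := A_large.
have i6 : 0 < A ^- 6 by rewrite invr_gt0 exprn_gt0.
have i9 : 0 < A ^- 9 by rewrite invr_gt0 exprn_gt0.
have i14 : 0 < A ^- 14 by rewrite invr_gt0 exprn_gt0.
have pm1 : 0 < A ^- 14 <= 1.
  by rewrite i14/= invf_le1 ?exprn_gt0// exprn_ege1//; lra.
have g8 : 0 < A ^- 6 <= 1 / 8.
  rewrite i6/= div1r lef_pV2 ?posrE ?exprn_gt0//.
  by rewrite (@le_trans _ _ A)//; [lra|rewrite ler_eXnr//; lra].
have pJ J' : J' \in sJ -> A ^- 14 <= p J'.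
  move=> Js; rewrite /p ler_pdivlMr//.
  exact: weight_lower MY he' e'_le1 cJ (csJ Js).
pose t : R := `|x - x'| / e; pose s : R := `|Ja.1 - Jb.1| / e'.
have in_left J' : J' \in sJ -> J'.1 \in `[J'.1, J'.2].
  by move=> Js; rewrite in_itv/= lexx; have [] := csJ Js.
have tE : `|x - x'| = t * e by rewrite divfK// gt_eqF.
have sE : `|Ja.1 - Jb.1| = s * e' by rewrite divfK// gt_eqF.
have := farI _ _ xI xI'; rewrite tE !ler_pM2r// => /andP[t1 t2].
have := farJ _ _ (in_left _ Jas) (in_left _ Jbs); rewrite sE !ler_pM2r// => /andP[s1 s2].
clearbody t s.
have /andP[tw1 tw2] := Phi_twist (subitv_in II xI1) (subitv_in II xI1') (left_in Jas) (left_in Jbs).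
have tauE : `|(psi Ja x - psi Jb x) - (psi Ja x' - psi Jb x')| =
   `|Phi x Ja.1 - Phi x Jb.1 - (Phi x' Ja.1 - Phi x' Jb.1)| / h.
  rewrite -[X in _ / X](@gtr0_norm _ h)// -normf_div; congr (`| _ |).
  by rewrite /psi; ring.
have scaleE : k * (t * e) * (s * e') = t * s * L * h.
  have -> : k * (t * e) * (s * e') = t * s * (e * e' * k) by ring.
  by rewrite balance; ring.
rewrite tE sE -!(mulrA 2) !scaleE in tw1 tw2.
have tau1 : t * s * L <= `|(psi Ja x - psi Jb x) - (psi Ja x' - psi Jb x')|.
  by rewrite tauE ler_pdivlMr.
have tau2 : `|(psi Ja x - psi Jb x) - (psi Ja x' - psi Jb x')| <= 2 * (t * s * L).
  by rewrite tauE ler_pdivrMr// (le_trans tw2)// mulrA.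
have L00 := L0.
suff : normc (F J x) ^+ 2 <= (1 - gamma) * Vsq \/ normc (F J x') ^+ 2 <= (1 - gamma) * Vsq.
  by case=> hle; [move: hx | move: hx']; rewrite ltNge hle.
rewrite !FE//.
apply: (phase_turn_gain (psi := psi) p_ge0 p_sum1 w0 NP pm1 g8 Jas Jbs (pJ _ Jas) (pJ _ Jbs) xI1 xI1').
- rewrite (le_trans tau2)// (le_trans _ P4)// ler_pM2l// ler_pM2r// expr2.
  by apply: ler_pM => //; exact: le_trans P2 _.
- have -> : 5 * `|x - x'| / w = 40 * A ^+ 2 * t.
    by rewrite tE /w; field; rewrite !gt_eqF.
  apply: (@lt_le_trans _ _ (t * (A ^+ 3 - 2 * A ^+ 2) / 2)); last first.
    rewrite -P3 ler_pM2r ?invr_gt0// (le_trans _ tau1)//.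
    rewrite -mulrA ler_wpM2l ?(le_trans P2)// ler_pM2r//.
  have A20 : 0 < A ^+ 2 by rewrite exprn_gt0.
  have t0 := le_trans P2 t1.
  have key : (A ^- 8 - 2 * A ^- 9) * A ^+ 2 * (A / 4 - 21) <= t * (A ^+ 2 * (A / 4 - 21)).
    by rewrite -mulrA ler_wpM2r// mulr_ge0 ?(ltW A20)//; lra.
  have u0 : 0 < t.
    have : 0 < t * (A ^+ 2 * (A / 4 - 21)).
      by rewrite (lt_le_trans _ key)// (lt_le_trans _ P1)// mulr_gt0.
    by rewrite pmulr_lgt0// mulr_gt0//; lra.
  have v0 : 0 < t * A ^+ 2 by rewrite mulr_gt0.
  have E3 : t * (A ^+ 3 - 2 * A ^+ 2) / 2 = t * A ^+ 2 * (A / 2 - 1) by field.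
  have E4 : 8 * A ^- 6 + 40 * A ^+ 2 * t = 8 * A ^- 6 + 40 * (t * A ^+ 2) by ring.
  rewrite E3 E4; move: (le_trans P1 key); rewrite mulrA.
  set v := t * A ^+ 2 in v0 *; set i := 8 * A ^- 6 => iv.
  have : 0 < v * (A / 4 - 20) by rewrite mulr_gt0//; lra.
  by move: iv; clearbody v i; lra.
Qed.

Lemma one_step :
  (\sum_(I' <- sI) mass muX I' * sup_lip_norm (F J) (weight (e / L)) I' ^+ 2) * mass muY J <=
  (1 - A ^- 40) * mass muX I * \sum_(J' <- sJ) mass muY J' * sup_lip_norm (F J') (weight e) I ^+ 2.
Proof.
have -> : \sum_(J' <- sJ) mass muY J' * sup_lip_norm (F J') (weight e) I ^+ 2 = Vsq * mass muY J.
  rewrite /Vsq mulr_suml; apply: eq_bigr => J' _; rewrite /p /N /w.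
  by field; rewrite gt_eqF.
rewrite [leRHS]mulrA ler_pM2r//.
have [I0 I0s gain] := norm_gain.
have [mX nX _] := MX.
rewrite (mass_splits mX nX spI).
have V0 : 0 <= Vsq by rewrite (le_trans _ SV)// sqr_ge0.
have low : A ^- 14 * mass muX I <= mass muX I0 by exact: weight_lower MX he e_le1 cI (csI I0s).
rewrite (mass_splits mX nX spI) in low.
have B (phi : R * R -> R) : \sum_(y <- sI) phi y = phi I0 + \sum_(y <- rem I0 sI) phi y.
  exact: big_rem.
have := low; rewrite (B (mass muX)) (B (fun y => mass muX y * _)).
set rest := \sum_(y <- rem I0 sI) mass muX y; set q := mass muX I0 => low0.
have rest_le : \sum_(y <- rem I0 sI) mass muX y * sup_lip_norm (F J) (weight (e / L)) y ^+ 2 <= rest * Vsq.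
  rewrite mulr_suml big_seq [leRHS]big_seq; apply: ler_sum => I' /mem_rem Is.
  by rewrite ler_wpM2l ?mass_ge0 ?norm_all.
have q0 : 0 <= q by exact: mass_ge0.
have first := ler_wpM2l q0 gain.
apply: le_trans (lerD first rest_le) _.
have /andP[g0 _] := gamma_small.
have E : A ^- 40 = gamma * A ^- 14 by rewrite /gamma; field; rewrite gt_eqF.
have := ler_wpM2l (ltW g0) low0; rewrite mulrA -E => h1.
have := ler_wpM2r V0 h1; lra.
Qed.

End OneStep.
End Contraction.

(** * Descending through all scales *)

Section Leaves.
Variables (R : realType) (X : set R) (L : R).
Hypothesis L_ge1 : 1 <= L.
Implicit Types (I J : R * R) (e : R).

Let L0 : 0 < L. Proof. exact: lt_le_trans L_ge1. Qed.

(** A chosen list of cells.  The default value is never met, since the choice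
    is only made for isolated intervals. *)
Definition pieces e I : seq (R * R) :=
  xget [::] [set s | splits X I s /\ forall J, J \in s -> cell X e J].

Lemma piecesP e I : 0 < e -> isolated X e I ->
  splits X I (pieces e I) /\ forall J, J \in pieces e I -> cell X e J.
Proof.
move=> e0 iso; have [s sp cs] := cell_splits e0 iso.
exact: (xgetPex [::] (P := [set s | splits X I s /\ forall J, J \in s -> cell X e J])
  (ex_intro _ s (conj sp cs))).
Qed.

Lemma isolated_le e e' I : e' <= e -> isolated X e I -> isolated X e' I.
Proof. by move=> ee' iso x Xx xI; have := iso x Xx xI; lra. Qed.

Lemma cell_pieces e I : 0 < e -> cell X e I ->
  splits X I (pieces (e / L) I) /\ forall J, J \in pieces (e / L) I -> cell X (e / L) J.
Proof.
move=> e0 [_ _ iso _]; apply: piecesP; first by rewrite divr_gt0.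
by apply: isolated_le iso; rewrite ler_pdivrMr// ler_peMr// ltW.
Qed.

Fixpoint leaves (n : nat) e I : seq (R * R) :=
  if n is n'.+1 then flatten [seq leaves n' (e / L) J | J <- pieces (e / L) I] else [:: I].

Lemma leaves_cell n e I J : 0 < e -> cell X e I -> J \in leaves n e I ->
  cell X (e / L ^+ n) J /\ subitv J I.
Proof.
elim: n e I => [|n IH] e I e0 cI /=.
  by rewrite expr0 divr1 inE => /eqP ->; split => //; split.
have [sp cs] := cell_pieces e0 cI.
move=> /flatten_mapP[I' I's JI']; have eL : 0 < e / L by rewrite divr_gt0.
have [cJ [J1 J2]] := IH _ _ eL (cs _ I's) JI'; rewrite exprS invfM mulrA; split => //.
by have [? ?] := splits_sub sp I's; split; lra.
Qed.

Lemma leaves_cover n e I x : 0 < e -> cell X e I -> X x -> x \in `[I.1, I.2] ->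
  exists2 J, J \in leaves n e I & x \in `[J.1, J.2].
Proof.
elim: n e I => [|n IH] e I e0 cI Xx xI /=; first by exists I => //; rewrite inE.
have [sp cs] := cell_pieces e0 cI.
have [I' I's xI'] := splits_cover sp Xx xI.
have eL : 0 < e / L by rewrite divr_gt0.
have [J Js xJ] := IH _ _ eL (cs _ I's) Xx xI'.
by exists J => //; apply/flatten_mapP; exists I'.
Qed.

Lemma leavesS_sum (V : nmodType) (phi : R * R -> V) n e I :
  \sum_(J <- leaves n.+1 e I) phi J =
  \sum_(J <- leaves n e I) \sum_(J' <- pieces (e / L ^+ n / L) J) phi J'.
Proof.
elim: n e I => [|n IH] e I.
  by rewrite /= big_flatten/= big_map big_seq1 expr0 divr1; apply: eq_bigr => J _; rewrite big_seq1.
rewrite [leaves n.+2 _ _]/= !big_flatten/= !big_map; apply: eq_bigr => I' _.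
have := IH (e / L) I'; rewrite /= => ->; apply: eq_bigr => J _.
by rewrite exprS invfM mulrA.
Qed.

Lemma leaves_additive (V : nmodType) (phi : R * R -> V) n e I :
  (forall J s, subitv J I -> splits X J s -> phi J = \sum_(J' <- s) phi J') ->
  0 < e -> cell X e I -> phi I = \sum_(J <- leaves n e I) phi J.
Proof.
elim: n e I => [|n IH] e I add e0 cI; first by rewrite big_seq1.
have [sp cs] := cell_pieces e0 cI.
rewrite (add I (pieces (e / L) I))//= big_flatten/= big_map big_seq [RHS]big_seq.
apply: eq_bigr => I' I's; apply: IH; [|by rewrite divr_gt0|exact: cs].
move=> J s [? ?]; apply: add; have [? ?] := splits_sub sp I's; split; lra.
Qed.

End Leaves.

Section Iterate.
Variables (R : realType) (A h k : R) (X Y : set R).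
Variables muX muY : {finite_measure set (measurableTypeR R) -> \bar R}.
Variables (Phi : R -> R -> R) (F : R * R -> R -> R[i]) (It Jt : R * R).
Hypotheses (h_gt0 : 0 < h) (k_gt0 : 0 < k) (A_large : 200 <= A).
Hypotheses (MX : multiscale A h X muX) (MY : multiscale A h Y muY).
Hypothesis Phi_twist : twist Phi k It Jt.
Hypothesis F_bounded : forall J w, 0 < w -> subitv J Jt -> exists N, sup_lip_bound (F J) w It N.
Hypothesis F_split : forall J s x, subitv J Jt -> splits Y J s -> 0 < mass muY J ->
  (forall J', J' \in s -> 0 < mass muY J') -> x \in `[It.1, It.2] ->
  F J x = \sum_(J' <- s) (mass muY J' / mass muY J)%:C *
             (expi ((Phi x J'.1 - Phi x J.1) / h) * F J' x).

Local Notation L := (A ^+ 11).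
Local Notation weight e := (e / (8 * A ^+ 2)).

(** Going down in [X] while going up in [Y], so that the product of the two
    scales is kept at the size where the phases turn. *)
Lemma iterated_contraction n (e e' : R) I J :
  subitv I It -> subitv J Jt -> cell X e I -> cell Y e' J -> 0 < e <= 1 -> 0 < e' <= 1 ->
  h <= e / L ^+ n -> h <= e' / L ^+ n -> e * e' * k = h * L ^+ n ->
  (\sum_(I' <- leaves X L n e I)
     mass muX I' * sup_lip_norm (F J) (weight (e / L ^+ n)) I' ^+ 2) * mass muY J <=
  (1 - A ^- 40) ^+ n * mass muX I *
    \sum_(J' <- leaves Y L n e' J) mass muY J' * sup_lip_norm (F J') (weight e) I ^+ 2.
Proof.
have A0 : 0 < A by apply: lt_le_trans A_large; rewrite ltr0n.
have A1 : 1 <= A by apply: le_trans A_large; rewrite ler1n.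
have L0 : 0 < L by rewrite exprn_gt0.
have L1 : 1 <= L by rewrite exprn_ege1.
have c0 : 0 <= 1 - A ^- 40.
  by rewrite subr_ge0 invf_le1 ?exprn_gt0// exprn_ege1.
elim: n e e' I J => [|n IH] e e' I J II JJ cI cJ /andP[e0 e1] /andP[e'0 e'1] he he' bal.
  by rewrite !big_seq1 !expr0 !divr1 le_eqVlt; apply/orP; left; apply/eqP; ring.
have eL0 : 0 < e / L by rewrite divr_gt0.
have eL1 : e / L <= 1.
  by rewrite ler_pdivrMr// mul1r (le_trans e1).
have Ln : 0 < L ^+ n by rewrite exprn_gt0.
have Ln1 : 1 <= L ^+ n by rewrite exprn_ege1.
have he1 : h <= e / L / L ^+ n by rewrite -mulrA -invfM -(exprS L).
have he1' : h <= e' / L ^+ n.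
  rewrite (le_trans he')// ler_pM2l// lef_pV2 ?posrE ?exprn_gt0//.
  by rewrite ler_weXn2l.
have he2 : h <= e / L.
  by rewrite (le_trans he1)// ler_pdivrMr// ler_peMr// ltW.
have [spI csI] := cell_pieces L1 e0 cI.
have bal1 : e / L * e' * k = h * L ^+ n.
  have -> : e / L * e' * k = (e * e' * k) / L by ring.
  by rewrite bal (exprS L); field; rewrite gt_eqF.
rewrite [leaves _ _ _ _ _ in X in X <= _]/= big_flatten/= big_map.
apply: (@le_trans _ _ (\sum_(I1 <- pieces X (e / L) I) (1 - A ^- 40) ^+ n * mass muX I1 *
    \sum_(J' <- leaves Y L n e' J) mass muY J' * sup_lip_norm (F J') (weight (e / L)) I1 ^+ 2)).
  rewrite mulr_suml big_seq [leRHS]big_seq; apply: ler_sum => I1 I1s.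
  have := IH (e / L) e' I1 J _ JJ (csI _ I1s) cJ _ _ he1 he1' bal1.
  have -> : e / L / L ^+ n = e / L ^+ n.+1 by rewrite -mulrA -invfM -(exprS L).
  rewrite eL0 eL1 e'0 e'1; apply => //.
  by have [? ?] := splits_sub spI I1s; case: II => ? ?; split; lra.
have -> : \sum_(I1 <- pieces X (e / L) I) (1 - A ^- 40) ^+ n * mass muX I1 *
    (\sum_(J' <- leaves Y L n e' J) mass muY J' * sup_lip_norm (F J') (weight (e / L)) I1 ^+ 2) =
  (1 - A ^- 40) ^+ n * \sum_(J' <- leaves Y L n e' J)
    (\sum_(I1 <- pieces X (e / L) I) mass muX I1 * sup_lip_norm (F J') (weight (e / L)) I1 ^+ 2) *
    mass muY J'.
  rewrite (eq_bigr (fun I1 => \sum_(J' <- leaves Y L n e' J) (1 - A ^- 40) ^+ n *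
     (mass muX I1 * sup_lip_norm (F J') (weight (e / L)) I1 ^+ 2 * mass muY J'))); last first.
    by move=> I1 _; rewrite mulr_sumr; apply: eq_bigr => J' _; ring.
  rewrite exchange_big/= mulr_sumr; apply: eq_bigr => J' _.
  by rewrite mulr_suml mulr_sumr.
rewrite (exprSr (1 - A ^- 40)) -!(mulrA ((1 - A ^- 40) ^+ n)) ler_wpM2l ?exprn_ge0//.
rewrite leavesS_sum mulr_sumr big_seq [leRHS]big_seq; apply: ler_sum => J' J's.
have [cJ' [J1 J2]] := leaves_cell L1 e'0 cJ J's.
have JJ' : subitv J' Jt by case: JJ => ? ?; split; lra.
have en0 : 0 < e' / L ^+ n by rewrite divr_gt0.
have [spJ csJ] := cell_pieces L1 en0 cJ'.
apply: (one_step h_gt0 k_gt0 A_large MX MY Phi_twist F_bounded F_split II JJ' cI cJ' e1 _ he2 _ _ spI csI spJ csJ).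
- by rewrite ler_pdivrMr// mul1r (le_trans e'1).
- by rewrite -mulrA -invfM -(exprSr L).
- have -> : e * (e' / L ^+ n) * k = (e * e' * k) / L ^+ n by ring.
  by rewrite bal (exprS L); field; rewrite gt_eqF.
Qed.

End Iterate.

(** * Amplitudes of the cells *)

Lemma weighted_cauchy_schwarz (R : realType) (T : eqType) (s : seq T) (m u : T -> R) :
  (forall b, 0 <= m b) ->
  (\sum_(b <- s) m b * u b) ^+ 2 <= (\sum_(b <- s) m b) * \sum_(b <- s) m b * u b ^+ 2.
Proof.
move=> m0; have M0 : 0 <= \sum_(b <- s) m b by rewrite sumr_ge0.
have [M00|M00] := eqVneq (\sum_(b <- s) m b) 0.
  have z b : b \in s -> m b = 0.
    by move=> bs; apply/eqP; rewrite eq_le m0 andbT -M00; exact: sum_ge_term.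
  rewrite M00 mul0r big_seq big1 ?expr0n// => b bs; by rewrite z// mul0r.
have M1 : 0 < \sum_(b <- s) m b by rewrite lt0r M00.
set M := \sum_(b <- s) m b in M0 M00 M1 *.
have p0 b : 0 <= m b / M by rewrite divr_ge0.
have p1 : \sum_(b <- s) m b / M = 1 by rewrite -mulr_suml divff.
have := sqr_mean_le p0 p1 u.
have E v : \sum_(c <- s) m c / M * v c = (\sum_(c <- s) m c * v c) / M.
  by rewrite mulr_suml; apply: eq_bigr => c _; ring.
rewrite !E exprMn exprVn ler_pdivlMr// => h; apply: le_trans (ler_wpM2l M0 h).
by rewrite le_eqVlt; apply/orP; left; apply/eqP; field.
Qed.

Section Amplitudes.
Variables (R : realType) (a b c d : R).
Hypotheses (ab : a < b) (cd : c < d).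
Local Notation I0 := (`[a, b]%classic).
Local Notation J0 := (`[c, d]%classic).
Variables (Phi : R -> R -> R) (G : R -> R -> R[i]) (Gm Gl h : R).
Hypotheses (C2 : C2_rect I0 J0 Phi) (C1 : C1_rect_complex I0 J0 G).
Hypothesis G_le : forall x y, I0 x -> J0 y -> normc (G x y) <= Gm.
Hypothesis G_lip : forall x x' y, I0 x -> I0 x' -> J0 y ->
  normc (G x y - G x' y) <= Gl * `|x - x'|.
Hypothesis h_gt0 : 0 < h.
Variables (Y : set R) (mu : {finite_measure set (measurableTypeR R) -> \bar R}).
Hypotheses (mY : measurable (Y : set (measurableTypeR R))) (muY : mu (~` Y) = 0%E).
Hypothesis YJ0 : Y `<=` J0.
Variable f : R -> R[i].
Hypothesis f_meas_Re : measurable_fun Y (fun t : measurableTypeR R => complex.Re (f t)).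
Hypothesis f_meas_Im : measurable_fun Y (fun t : measurableTypeR R => complex.Im (f t)).
Hypothesis f_int : mu.-integrable Y (EFin \o (fun t => normc (f t))).
Hypothesis f_int2 : mu.-integrable Y (EFin \o (fun t => normc (f t) ^+ 2)).
Implicit Types (I J : R * R) (x y : R).

Let kern x y := expi (Phi x y / h) * G x y.

Definition in_cell J : set (measurableTypeR R) := Y `&` `[J.1, J.2]%classic.

Lemma measurable_in_cell J : measurable (in_cell J).
Proof. by apply: measurableI => //; exact: measurable_itv. Qed.

Lemma mass_in_cell J : mass mu J = fine (mu (in_cell J)).
Proof.
rewrite /mass; congr fine; apply: le_anti; apply/andP; split.
  by apply: (mass_le_on mY muY (measurable_in_cell J)) => x Yx xJ; split.
apply: le_measure; rewrite ?inE; [exact: measurable_in_cell|exact: measurable_itv|].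
by move=> x [].
Qed.

Let slice_measurable (u : R -> R) : (forall y, J0 y -> derivable_on J0 u y) ->
  measurable_fun Y (u : measurableTypeR R -> R).
Proof.
move=> du; apply: (@measurable_funS _ _ _ _ J0) => //.
by apply: subspace_continuous_measurable_fun => //; exact: derivable_on_continuous.
Qed.

Lemma kernel_integrable x : I0 x -> integrableC mu Y (fun y => kern x y * f y).
Proof.
move=> Ix; have [[dPhi _ _ _] _ _] := C2; have [[dRe _ _ _] [dIm _ _ _]] := C1.
have mP : measurable_fun Y (fun y : measurableTypeR R => Phi x y / h).
  by apply: measurable_funM => //; apply: slice_measurable => y Jy; have [] := dPhi x y Ix Jy.
have mR : measurable_fun Y (fun y : measurableTypeR R => complex.Re (G x y)).
  by apply: slice_measurable => y Jy; have [] := dRe x y Ix Jy.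
have mI : measurable_fun Y (fun y : measurableTypeR R => complex.Im (G x y)).
  by apply: slice_measurable => y Jy; have [] := dIm x y Ix Jy.
have mc : measurable_fun Y (fun y : measurableTypeR R => cos (Phi x y / h)).
  apply: (@measurableT_comp _ _ _ _ _ _ (@cos R)) => //.
  by apply: continuous_measurable_fun; exact: continuous_cos.
have ms : measurable_fun Y (fun y : measurableTypeR R => sin (Phi x y / h)).
  apply: (@measurableT_comp _ _ _ _ _ _ (@sin R)) => //.
  by apply: continuous_measurable_fun; exact: continuous_sin.
have le_norm y : Y y -> normc (kern x y * f y) <= Gm * normc (f y).
  move=> Yy; rewrite !Normc.normcM normc_expi mul1r ler_wpM2r ?normc_ge0//.
  by apply: G_le => //; exact: YJ0.
have dom : mu.-integrable Y (EFin \o (fun y => Gm * normc (f y))).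
  by apply: (eq_integrable mY _ _ _ (integrableZl mY Gm f_int)) => t _; rewrite /= EFinM.
have mkR : measurable_fun Y (fun y : measurableTypeR R => complex.Re (kern x y)).
  have -> : (fun y => complex.Re (kern x y)) = (fun y =>
      cos (Phi x y / h) * complex.Re (G x y) - sin (Phi x y / h) * complex.Im (G x y)).
    by apply/funext => y; rewrite /kern; case: (G x y).
  by apply: measurable_funB; exact: measurable_funM.
have mkI : measurable_fun Y (fun y : measurableTypeR R => complex.Im (kern x y)).
  have -> : (fun y => complex.Im (kern x y)) = (fun y =>
      cos (Phi x y / h) * complex.Im (G x y) + sin (Phi x y / h) * complex.Re (G x y)).
    by apply/funext => y; rewrite /kern; case: (G x y).
  by apply: measurable_funD; exact: measurable_funM.
split.
- apply: (le_integrable mY _ _ dom).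
    apply/measurable_EFinP.
    have -> : (fun y => complex.Re (kern x y * f y)) = (fun y =>
       complex.Re (kern x y) * complex.Re (f y) - complex.Im (kern x y) * complex.Im (f y)).
      by apply/funext => y; case: (kern x y) (f y) => ? ? [].
    by apply: measurable_funB; exact: measurable_funM.
  move=> y Yy /=; rewrite lee_fin (le_trans (normc_ge_Re_Im _).1)//.
  by rewrite (le_trans (le_norm y Yy))// ler_norm.
- apply: (le_integrable mY _ _ dom).
    apply/measurable_EFinP.
    have -> : (fun y => complex.Im (kern x y * f y)) = (fun y =>
       complex.Re (kern x y) * complex.Im (f y) + complex.Im (kern x y) * complex.Re (f y)).
      by apply/funext => y; case: (kern x y) (f y) => ? ? [].
    by apply: measurable_funD; exact: measurable_funM.
  move=> y Yy /=; rewrite lee_fin (le_trans (normc_ge_Re_Im _).2)//.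
  by rewrite (le_trans (le_norm y Yy))// ler_norm.
Qed.

Definition cell_integral J x : R[i] := integralC mu (in_cell J) (fun y => kern x y * f y).

(** The contribution of a cell [J], normalised by its mass, and with the
    phase at an endpoint of [J] divided out, so that it varies slowly. *)
Definition amplitude J x : R[i] :=
  ((mass mu J)^-1)%:C * (expi (- (Phi x J.1 / h)) * cell_integral J x).

Lemma in_cell_cut J z z' : J.1 <= z -> z < z' -> z' <= J.2 ->
  (forall y, Y y -> y \notin `[z, z']) ->
  in_cell J = in_cell (J.1, z) `|` in_cell (z', J.2) /\
  in_cell (J.1, z) `&` in_cell (z', J.2) = set0.
Proof.
move=> Jz zz' zJ miss; split; apply/seteqP; split => //= y.
- move=> [Yy]; rewrite /= in_itv/= => /andP[? ?].
  by have [?|?] := notin_itvcc (miss y Yy); [left|right]; split => //; rewrite /= in_itv/=;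
    apply/andP; split; lra.
- by case=> -[Yy]; rewrite /= in_itv/= => /andP[? ?]; split => //; rewrite /= in_itv/=;
    apply/andP; split; lra.
- by move=> [[_ +] [_]]; rewrite /= !in_itv/= => /andP[? ?] /andP[? ?]; lra.
Qed.

Lemma in_cell_miss J : (forall y, Y y -> y \notin `[J.1, J.2]) -> in_cell J = set0.
Proof.
move=> miss; apply/seteqP; split => // y [Yy] /=.
by move=> yJ; have := miss y Yy; rewrite yJ.
Qed.

Lemma cell_integral_splits I s x : I0 x -> splits Y I s ->
  cell_integral I x = \sum_(J <- s) cell_integral J x.
Proof.
move=> Ix; apply: (splits_additive (phi := fun J => cell_integral J x)) => [J miss|J z z' _ Jz zz' zJ _ miss].
  by rewrite /cell_integral in_cell_miss// integralC_set0.
have [E E0] := in_cell_cut Jz zz' zJ miss.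
rewrite /cell_integral E integralC_setU//; [exact: measurable_in_cell..|].
apply: integrableCS (kernel_integrable Ix) => //; last by move=> y [] [].
by apply: measurableU; exact: measurable_in_cell.
Qed.

Lemma sqr_integral_splits I s : splits Y I s ->
  Rintegral mu (in_cell I) (fun y => normc (f y) ^+ 2) =
  \sum_(J <- s) Rintegral mu (in_cell J) (fun y => normc (f y) ^+ 2).
Proof.
apply: (splits_additive (phi := fun J => Rintegral mu (in_cell J) (fun y => normc (f y) ^+ 2)))
  => [J miss|J z z' _ Jz zz' zJ _ miss].
  by rewrite in_cell_miss// Rintegral_set0.
have [E E0] := in_cell_cut Jz zz' zJ miss.
rewrite E Rintegral_setU//; [exact: measurable_in_cell..| |exact/disj_set2P].
apply: integrableS f_int2 => //; last by move=> y [] [].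
by apply: measurableU; exact: measurable_in_cell.
Qed.

Lemma amplitude_split J s x : I0 x -> splits Y J s -> 0 < mass mu J ->
  (forall J', J' \in s -> 0 < mass mu J') ->
  amplitude J x = \sum_(J' <- s) (mass mu J' / mass mu J)%:C *
             (expi ((Phi x J'.1 - Phi x J.1) / h) * amplitude J' x).
Proof.
move=> Ix sp mJ ms; rewrite /amplitude (cell_integral_splits Ix sp) !mulr_sumr.
rewrite big_seq [RHS]big_seq; apply: eq_bigr => J' /ms mJ'.
have -> : - (Phi x J.1 / h) = (Phi x J'.1 - Phi x J.1) / h - Phi x J'.1 / h by ring.
rewrite expi_add.
have -> : ((mass mu J)^-1)%:C = (mass mu J' / mass mu J)%:C * ((mass mu J')^-1)%:C.
  by rewrite -rmorphM; congr (_ %:C); field; rewrite !gt_eqF.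
ring.
Qed.

Lemma cell_integralE J x : 0 < mass mu J -> cell_integral J x =
  (mass mu J)%:C * (expi (Phi x J.1 / h) * amplitude J x).
Proof.
move=> mJ; rewrite /amplitude; set z := cell_integral J x.
have E1 : (mass mu J)%:C * ((mass mu J)^-1)%:C = 1 :> R[i].
  by rewrite -rmorphM divff ?gt_eqF.
have E2 : expi (Phi x J.1 / h) * expi (- (Phi x J.1 / h)) = 1.
  by rewrite -expi_add subrr expi0.
rewrite -[LHS]mul1r -[in LHS]E1 -[LHS]mul1r -[in LHS]E2; ring.
Qed.

Definition mean_modulus J := (mass mu J)^-1 * Rintegral mu (in_cell J) (fun y => normc (f y)).

(** At a scale where [J] is so short that the phase is almost constant, the
    amplitude is controlled by the mean of the modulus of [f]. *)
Lemma amplitude_bound (k w B : R) It J : 0 < w -> 0 < k ->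
  a <= It.1 -> It.2 <= b -> c <= J.1 -> J.2 <= d -> twist Phi k It J ->
  Gm <= B -> w * (Gm * (2 * k * (J.2 - J.1) / h) + Gl) <= B ->
  0 <= Gm -> sup_lip_bound (amplitude J) w It (2 * B * mean_modulus J).
Proof.
move=> w0 k0 aI Ib cJ Jd tw GB wB Gm0.
have mJ := measurable_in_cell J.
have mean0 : 0 <= mean_modulus J.
  by rewrite mulr_ge0 ?invr_ge0 ?mass_ge0// Rintegral_ge0// => y _; exact: normc_ge0.
have inI x : x \in `[It.1, It.2] -> I0 x.
  by rewrite !in_itv/= in_itv/= => /andP[? ?]; apply/andP; split; lra.
pose K x y := expi (- (Phi x J.1 / h)) * (kern x y * f y).
have KE x y : K x y = expi ((Phi x y - Phi x J.1) / h) * G x y * f y.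
  have -> : (Phi x y - Phi x J.1) / h = - (Phi x J.1 / h) + Phi x y / h by ring.
  by rewrite expi_add /K /kern; ring.
have cellY : in_cell J `<=` Y by move=> y [].
have intk x : I0 x -> integrableC mu (in_cell J) (fun y => kern x y * f y).
  by move=> Ix; apply: integrableCS (kernel_integrable Ix).
have intK x : I0 x -> integrableC mu (in_cell J) (K x).
  by move=> Ix; apply: integrableCZ => //; exact: intk.
have ampE x : I0 x -> amplitude J x = ((mass mu J)^-1)%:C * integralC mu (in_cell J) (K x).
  by move=> Ix; rewrite /amplitude /cell_integral -(integralCZ _ mJ (intk x Ix)).
have fint : mu.-integrable (in_cell J) (EFin \o (fun y => normc (f y))).
  exact: integrableS f_int.
have scaleB q z : normc z <= 2 * q * Rintegral mu (in_cell J) (fun y => normc (f y)) ->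
    normc (((mass mu J)^-1)%:C * z) <= 2 * q * mean_modulus J.
  move=> zq; rewrite Normc.normcM normc_real ger0_norm ?invr_ge0 ?mass_ge0//.
  by rewrite /mean_modulus mulrCA ler_wpM2l// invr_ge0 mass_ge0.
split.
- by apply: mulr_ge0 => //; rewrite mulr_ge0// (le_trans Gm0).
- move=> x xI; have Ix := inI x xI; rewrite ampE//.
  apply: scaleB; apply: normc_integralC => //; first exact: intK.
  move=> y [Yy _]; rewrite KE !Normc.normcM normc_expi mul1r.
  by rewrite ler_wpM2r ?normc_ge0// (le_trans _ GB)// G_le//; exact: YJ0.
- move=> x x' xI xI'; have Ix := inI x xI; have Ix' := inI x' xI'.
  rewrite !ampE// -mulrBr -integralCB//; [|exact: intK..].
  pose q := (Gm * (2 * k * (J.2 - J.1) / h) + Gl) * `|x - x'|.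
  have : normc (((mass mu J)^-1)%:C * integralC mu (in_cell J) (fun y => K x y - K x' y)) <= 2 * q * mean_modulus J.
    apply: scaleB; apply: normc_integralC => //.
      by apply: integrableCB => //; exact: intK.
    move=> y [Yy yJ]; rewrite !KE -mulrBl Normc.normcM ler_wpM2r ?normc_ge0//.
    have Jy := YJ0 Yy.
    have -> : expi ((Phi x y - Phi x J.1) / h) * G x y - expi ((Phi x' y - Phi x' J.1) / h) * G x' y =
      (expi ((Phi x y - Phi x J.1) / h) - expi ((Phi x' y - Phi x' J.1) / h)) * G x y +
      expi ((Phi x' y - Phi x' J.1) / h) * (G x y - G x' y) by ring.
    rewrite (le_trans (normc_triangle _ _))// !Normc.normcM normc_expi mul1r /q [leRHS]mulrDl.
    apply: lerD; last exact: G_lip.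
    rewrite mulrC (le_trans (ler_pM _ _ (G_le Ix Jy) (expi_dist_le _ _))) ?normc_ge0//.
    rewrite -mulrA ler_wpM2l// -mulrBl normrM (@ger0_norm _ h^-1) ?invr_ge0 ?(ltW h_gt0)//.
    have /andP[y1 y2] : J.1 <= y <= J.2 by [].
    have J12 : J.1 \in `[J.1, J.2] by rewrite in_itv/= lexx (le_trans y1).
    have /andP[_ t] := tw x x' y J.1 xI xI' yJ J12.
    rewrite ler_pdivrMr// (le_trans t)//.
    have -> : 2 * k * (J.2 - J.1) / h * `|x - x'| * h = 2 * k * `|x - x'| * (J.2 - J.1).
      by field; rewrite gt_eqF.
    rewrite ler_wpM2l ?mulr_ge0 ?(ltW k0)//.
    by rewrite ger0_norm; lra.
  move=> hq; rewrite (le_trans (ler_wpM2l (ltW w0) hq))//.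
  have := ler_wpM2r (mulr_ge0 mean0 (normr_ge0 (x - x'))) wB; rewrite /q; lra.
Qed.

Lemma mean_modulus_sqr J : 0 < mass mu J ->
  mass mu J * mean_modulus J ^+ 2 <= Rintegral mu (in_cell J) (fun y => normc (f y) ^+ 2).
Proof.
move=> mJ; have mc := measurable_in_cell J.
have cellY : in_cell J `<=` Y by move=> y [].
have i1 : mu.-integrable (in_cell J) (EFin \o (fun y => normc (f y))) by exact: integrableS f_int.
have i2 : mu.-integrable (in_cell J) (EFin \o (fun y => normc (f y) ^+ 2)) by exact: integrableS f_int2.
have ic r : mu.-integrable (in_cell J) (EFin \o (fun=> r)) by apply: finite_measure_integrable_cst.
set m := mean_modulus J.
have : 2 * m * Rintegral mu (in_cell J) (fun y => normc (f y)) - m ^+ 2 * mass mu J <=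
    Rintegral mu (in_cell J) (fun y => normc (f y) ^+ 2).
  have iz : mu.-integrable (in_cell J) (EFin \o (fun y => 2 * m * normc (f y))).
    by apply: (eq_integrable mc _ _ _ (integrableZl mc (2 * m) i1)) => t _; rewrite /= EFinM.
  rewrite -RintegralZl// mass_in_cell -Rintegral_cst// -RintegralB//.
  apply: le_Rintegral => //; first exact: (eq_integrable mc _ _ _ (integrableB mc iz (ic (m ^+ 2)))).
  by move=> y _; have := sqr_ge0 (normc (f y) - m); rewrite sqrrB; lra.
have -> : Rintegral mu (in_cell J) (fun y => normc (f y)) = mass mu J * m.
  by rewrite /m /mean_modulus mulVKf// gt_eqF.
lra.
Qed.


Lemma in_cell_all : in_cell (c, d) = Y.
Proof.
by apply/seteqP; split => y; [case|move=> Yy; split => //; exact: YJ0].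
Qed.

(** Weighting the cells by their masses avoids counting them. *)
Lemma oscB_sqr_le s x : I0 x -> splits Y (c, d) s -> (forall J, J \in s -> 0 < mass mu J) ->
  normc (oscB Phi G Y mu h f x) ^+ 2 <=
  mass mu (c, d) * \sum_(J <- s) mass mu J * normc (amplitude J x) ^+ 2.
Proof.
move=> Ix sp ms.
have -> : oscB Phi G Y mu h f x = cell_integral (c, d) x by rewrite /cell_integral in_cell_all.
rewrite (cell_integral_splits Ix sp) (mass_splits mY muY sp).
apply: le_trans (weighted_cauchy_schwarz _ _ (mass_ge0 mu)).
rewrite ler_sqr ?nnegrE ?normc_ge0//; last first.
  by rewrite sumr_ge0// => J _; rewrite mulr_ge0 ?mass_ge0 ?normc_ge0.
rewrite (le_trans (normc_sum _ _ _))// big_seq [leRHS]big_seq; apply: ler_sum => J Js.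
by rewrite (cell_integralE _ (ms J Js)) !Normc.normcM normc_expi mul1r normc_real ger0_norm ?mass_ge0.
Qed.

Lemma oscB_le x : I0 x -> 0 <= Gm -> Rintegral mu Y (fun y => normc (f y) ^+ 2) <= 1 ->
  normc (oscB Phi G Y mu h f x) <= Gm * (mass mu (c, d) + 1).
Proof.
move=> Ix Gm0 f1.
have ic : mu.-integrable Y (EFin \o (fun=> 1)) by apply: finite_measure_integrable_cst.
have iD := integrableD mY ic f_int2.
have n_le : 2 * Rintegral mu Y (fun y => normc (f y)) <= mass mu (c, d) + 1.
  rewrite mass_in_cell in_cell_all -[fine (mu Y)]mul1r -Rintegral_cst//.
  rewrite -RintegralZl//; apply: le_trans (lerD (lexx _) f1).
  rewrite -RintegralD//; apply: le_Rintegral => //.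
    by apply: (eq_integrable mY _ _ _ (integrableZl mY 2 f_int)) => t _; rewrite /= EFinM.
  by move=> y _; have := sqr_ge0 (normc (f y) - 1); rewrite sqrrB1; lra.
apply: le_trans (ler_wpM2l Gm0 n_le).
rewrite mulrCA mulrA; apply: normc_integralC => //; first exact: kernel_integrable.
move=> y Yy; rewrite !Normc.normcM normc_expi mul1r ler_wpM2r ?normc_ge0// G_le//.
exact: YJ0.
Qed.

Section PairOfCells.
Variables (A : R) (X : set R) (muX : {finite_measure set (measurableTypeR R) -> \bar R}).
Hypothesis A_large : 200 <= A.
Hypotheses (MX : multiscale A h X muX) (MY : multiscale A h Y mu).
Hypotheses (Gm0 : 0 <= Gm) (Gl0 : 0 <= Gl).

Local Notation L := (A ^+ 11).
Local Notation weight e := (e / (8 * A ^+ 2)).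

(** The scale at which [X] is cut inside the top cell [I] is adapted to the
    local size [k] of the mixed derivative, so that a whole number of steps
    leads exactly to the scale of the oscillation. *)
Lemma pair_estimate (k e1 q : R) I J :
  cell X e1 I -> cell Y e1 J -> subitv I (a, b) -> subitv J (c, d) ->
  twist Phi k I J -> 0 < k -> 0 < e1 <= 1 -> k * e1 <= 1 -> h <= k * e1 ^+ 2 ->
  0 <= q -> 1 - A ^- 40 <= L `^ (- q) ->
  exists T : seq (R * R * R), [/\ forall p, p \in T -> 0 <= p.2,
    forall x, X x -> x \in `[I.1, I.2] -> exists2 p, p \in T &
      x \in `[p.1.1, p.1.2] /\ normc (amplitude J x) ^+ 2 <= p.2 &
    (\sum_(p <- T) p.2 * mass muX p.1) * mass mu J <=
      4 * (Gm + Gl) ^+ 2 * (h * L / (k * e1 ^+ 2)) `^ q * mass muX I *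
      Rintegral mu (in_cell J) (fun y => normc (f y) ^+ 2) ].
Proof.
move=> cI cJ [/= aI Ib] [/= cJ' Jd] tw k0 /andP[e0 e1_le] ke1 hk q0 rate.
have A0 : 0 < A by apply: lt_le_trans A_large; rewrite ltr0n.
have A1 : 1 <= A by apply: le_trans A_large; rewrite ler1n.
have L0 : 0 < L by rewrite exprn_gt0.
have L1 : 1 <= L by rewrite exprn_ege1.
have L2 : 2 <= L.
  by rewrite (@le_trans _ _ A)//; [apply: le_trans A_large; rewrite ler_nat|rewrite ler_eXnr].
have c0 : 0 <= 1 - A ^- 40 by rewrite subr_ge0 invf_le1 ?exprn_gt0// exprn_ege1.
(* [n] is the number of whole steps; the remaining factor, less than [L], goes
   into the scale [eX] at which [X] is cut. *)
pose u := k * e1 ^+ 2 / h.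
have u1 : 1 <= u by rewrite ler_pdivlMr// mul1r.
have [n nL uL] : exists2 n : nat, L ^+ n <= u & u < L ^+ n.+1.
  have ex : exists n : nat, u < L ^+ n.+1.
    exists (Num.truncn u); rewrite (lt_le_trans (truncnS_gt u))//.
    apply: le_trans (lerXn2r _ _ _ L2); rewrite ?nnegrE ?(ltW L0)//.
    by rewrite -natrX ler_nat ltnW// ltn_expl.
  case: (ex_minnP ex) => -[|m] um min_m; first by exists 0%N => //; rewrite expr0.
  exists m.+1 => //; rewrite leNgt; apply/negP => um'.
  by have := min_m m um'; rewrite ltnn.
have Ln0 : 0 < L ^+ n by rewrite exprn_gt0.
pose eX := h * L ^+ n / (k * e1).
have ke0 : 0 < k * e1 by rewrite mulr_gt0.
have eX0 : 0 < eX by rewrite divr_gt0// mulr_gt0.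
have eXe : eX <= e1.
  rewrite ler_pdivrMr// mulrC -ler_pdivlMr// (le_trans nL)// /u.
  by rewrite le_eqVlt; apply/orP; left; apply/eqP; field; rewrite gt_eqF.
have bal : eX * e1 * k = h * L ^+ n by rewrite /eX; field; rewrite !gt_eqF.
have hX : h <= eX / L ^+ n.
  have -> : eX / L ^+ n = h / (k * e1) by rewrite /eX; field; rewrite !gt_eqF.
  by rewrite ler_pdivlMr// ler_piMr// ltW.
have hY : h <= e1 / L ^+ n by rewrite (le_trans hX)// ler_pM2r// invr_gt0.
have isoX : isolated X eX I by case: cI => _ _ iso _; exact: isolated_le iso.
have [spX csX] := piecesP eX0 isoX.
have JJ : subitv J J by [].
have [lenY posY] : (forall e K, h <= e <= 1 -> cell Y e K -> K.2 - K.1 <= A ^+ 2 * e) /\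
    (forall e K, h <= e <= 1 -> cell Y e K -> 0 < mass mu K).
  by case: MY => _ _ [].
have Gml0 : 0 <= Gm + Gl by rewrite addr_ge0.
have w_gt0 e : 0 < e -> 0 < weight e.
  by move=> ?; rewrite divr_gt0// mulr_gt0// exprn_gt0.
have twS K : subitv K J -> twist Phi k I K.
  by move=> KJ x x' y y' xI xI' /(subitv_in KJ) yK /(subitv_in KJ) yK'; exact: tw.
have bounded K w : 0 < w -> subitv K J -> exists N, sup_lip_bound (amplitude K) w I N.
  move=> w0 KJ; have [K1 K2] := KJ.
  set v := w * (Gm * (2 * k * (K.2 - K.1) / h) + Gl).
  exists (2 * (Gm + `|v|) * mean_modulus K).
  apply: (amplitude_bound w0 k0 aI Ib (le_trans cJ' K1) (le_trans K2 Jd) (twS _ KJ)) => //.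
    by rewrite lerDl.
  by rewrite -/v (le_trans (ler_norm v))// lerDr.
have split_amp K s x : subitv K J -> splits Y K s -> 0 < mass mu K ->
  (forall J', J' \in s -> 0 < mass mu J') -> x \in `[I.1, I.2] ->
  amplitude K x = \sum_(J' <- s) (mass mu J' / mass mu K)%:C *
             (expi ((Phi x J'.1 - Phi x K.1) / h) * amplitude J' x).
  move=> _ sp mK ms xI; apply: amplitude_split => //.
  by move: xI; rewrite /= !in_itv/= => /andP[? ?]; apply/andP; split; lra.
pose nrm K := sup_lip_norm (amplitude J) (weight (eX / L ^+ n)) K.
have weX : 0 < weight (eX / L ^+ n) by apply: w_gt0; rewrite divr_gt0.
have nrmP K : subitv K I -> sup_lip_bound (amplitude J) (weight (eX / L ^+ n)) K (nrm K).
  move=> KI; apply: sup_lip_normP; have [N hN] := bounded J _ weX JJ.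
  by exists N; exact: sup_lip_boundS hN.
pose T := [seq (K, nrm K ^+ 2) | K <- flatten [seq leaves X L n eX I1 | I1 <- pieces X eX I]].
have leaf_sub I1 K : I1 \in pieces X eX I -> K \in leaves X L n eX I1 -> subitv K I.
  move=> I1s Ks; have [_ [? ?]] := leaves_cell L1 eX0 (csX _ I1s) Ks.
  by have [? ?] := splits_sub spX I1s; split; lra.
exists T; split.
- by move=> p /mapP[K _ ->] /=; exact: sqr_ge0.
- move=> x Xx xI; have [I1 I1s xI1] := splits_cover spX Xx xI.
  have [K Ks xK] := leaves_cover L1 n eX0 (csX _ I1s) Xx xI1.
  exists (K, nrm K ^+ 2).
    by apply: map_f; apply/flatten_mapP; exists I1.
  split => //=; have [n0 hn _] := nrmP K (leaf_sub _ _ I1s Ks).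
  by rewrite ler_sqr ?nnegrE ?normc_ge0// hn.
have rate_n : (1 - A ^- 40) ^+ n <= (h * L / (k * e1 ^+ 2)) `^ q.
  rewrite (le_trans (lerXn2r n _ _ rate)) ?nnegrE ?powR_ge0//.
  have -> : (L `^ (- q)) ^+ n = (L ^- n) `^ q.
    rewrite -(powR_mulrn n (powR_ge0 _ _)) -powRrM -(powR_mulrn n (ltW L0)) -powRN -powRrM.
    by congr (_ `^ _); ring.
  have ke2 : 0 < k * e1 ^+ 2 by rewrite mulr_gt0// exprn_gt0.
  apply: ge0_ler_powR => //.
  - by rewrite nnegrE invr_ge0 ltW.
  - by rewrite nnegrE ltW// divr_gt0// mulr_gt0.
  rewrite ler_pdivlMr// ler_pdivrMl//.
  have := ltW uL; rewrite ler_pdivrMr// (exprS L) => h1; apply: (le_trans h1).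
  by rewrite le_eqVlt; apply/orP; left; apply/eqP; ring.
rewrite /T big_map big_flatten/= big_map.
have step I1 : I1 \in pieces X eX I ->
  (\sum_(K <- leaves X L n eX I1) nrm K ^+ 2 * mass muX K) * mass mu J <=
  (1 - A ^- 40) ^+ n * mass muX I1 *
   (4 * (Gm + Gl) ^+ 2 * Rintegral mu (in_cell J) (fun y => normc (f y) ^+ 2)).
  move=> I1s.
  have I1I : subitv I1 I := splits_sub spX I1s.
  have e1_1 : 0 < e1 <= 1 by rewrite e0.
  have eX_1 : 0 < eX <= 1 by rewrite eX0 (le_trans eXe).
  have := iterated_contraction h_gt0 k0 A_large MX MY tw bounded split_amp I1I JJ
     (csX _ I1s) cJ eX_1 e1_1 hX hY bal.
  under eq_bigr do rewrite mulrC.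
  move=> h1; apply: (le_trans h1).
  rewrite ler_wpM2l ?mulr_ge0 ?exprn_ge0 ?mass_ge0//.
  have -> : Rintegral mu (in_cell J) (fun y => normc (f y) ^+ 2) =
     \sum_(J' <- leaves Y L n e1 J) Rintegral mu (in_cell J') (fun y => normc (f y) ^+ 2).
    pose phi K := Rintegral mu (in_cell K) (fun y => normc (f y) ^+ 2).
    apply: (@leaves_additive R Y L L1 _ phi n e1 J _ e0 cJ) => K s _ sp.
    exact: sqr_integral_splits.
  rewrite mulr_sumr big_seq [leRHS]big_seq; apply: ler_sum => J' J's.
  have [cJJ' JJ'] := leaves_cell L1 e0 cJ J's.
  have hn1 : h <= e1 / L ^+ n <= 1.
    by rewrite hY ler_pdivrMr// mul1r (le_trans e1_le)// exprn_ege1.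
  have mJ' := posY _ _ hn1 cJJ'.
  have lJ' := lenY _ _ hn1 cJJ'.
  have bJ : sup_lip_bound (amplitude J') (weight eX) I1 (2 * (Gm + Gl) * mean_modulus J').
    apply: (sup_lip_boundS I1I); have [J1 J2] := JJ'.
    apply: (amplitude_bound (w_gt0 _ eX0) k0 aI Ib (le_trans cJ' J1) (le_trans J2 Jd) (twS _ JJ')) => //.
      by rewrite lerDl.
    have w1 : weight eX <= 1.
      rewrite ler_pdivrMr ?mulr_gt0 ?exprn_gt0// mul1r (le_trans eXe)// (le_trans e1_le)//.
      by have : 1 <= A ^+ 2; [rewrite exprn_ege1|lra].
    have w0 := w_gt0 _ eX0.
    rewrite mulrDr; apply: lerD; last by rewrite ler_piMl.
    have : 2 * k * (J'.2 - J'.1) / h <= 2 * k * (A ^+ 2 * (e1 / L ^+ n)) / h.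
      by rewrite ler_wpM2r ?invr_ge0 ?(ltW h_gt0)// ler_wpM2l// mulr_ge0// ltW.
    move=> l1; have := ler_wpM2l (mulr_ge0 (ltW w0) Gm0) l1.
    have -> : weight eX * Gm * (2 * k * (A ^+ 2 * (e1 / L ^+ n)) / h) =
      Gm / 4 * ((eX * e1 * k) / (h * L ^+ n)) by field; rewrite !gt_eqF.
    rewrite bal divff ?gt_eqF ?mulr_gt0// mulr1 -mulrA => l2.
    by apply: (le_trans l2); have := Gm0; lra.
  have n0 := sup_lip_norm_ge0 (ex_intro _ _ bJ).
  have b2 : sup_lip_norm (amplitude J') (weight eX) I1 ^+ 2 <= (2 * (Gm + Gl) * mean_modulus J') ^+ 2.
    by rewrite ler_sqr ?nnegrE ?(sup_lip_norm_le bJ)//; have [] := bJ.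
  have := mean_modulus_sqr mJ'.
  move/(ler_wpM2l (mulr_ge0 (ler0n _ 4) (sqr_ge0 (Gm + Gl)))) => b3.
  apply: le_trans b3; have := ler_wpM2l (mass_ge0 mu J') b2.
  by move/le_trans; apply; rewrite le_eqVlt; apply/orP; left; apply/eqP; ring.
rewrite mulr_suml big_seq.
apply: (le_trans (ler_sum _ step)).
rewrite -big_seq -mulr_suml -mulr_sumr.
have [mX nX _] := MX.
rewrite -(mass_splits mX nX spX).
set D := Rintegral _ _ _.
have D0 : 0 <= D by rewrite Rintegral_ge0// => y _; exact: sqr_ge0.
have E : (4 * (Gm + Gl) ^+ 2 * (h * L / (k * e1 ^+ 2)) `^ q * mass muX I * D) =
  (h * L / (k * e1 ^+ 2)) `^ q * (mass muX I * (4 * (Gm + Gl) ^+ 2 * D)) by ring.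
rewrite E -mulrA ler_wpM2r// !mulr_ge0 ?mass_ge0//; exact: sqr_ge0.
Qed.

End PairOfCells.
End Amplitudes.

(** * Majorants and constants *)

Section Majorants.
Variables (R : realType) (mu : {finite_measure set (measurableTypeR R) -> \bar R}).

(** The integral of a non-negative function is a supremum over the simple
    functions below it, so it is monotone without any measurability. *)
Lemma ge0_integral_mono (f g : measurableTypeR R -> \bar R) :
  (forall x, (0 <= f x)%E) -> (forall x, (f x <= g x)%E) ->
  (\int[mu]_x f x <= \int[mu]_x g x)%E.
Proof.
move=> f0 fg; have g0 x : (0 <= g x)%E by exact: le_trans (fg x).
rewrite !ge0_integralTE//; apply: le_ereal_sup => _ [u /= hu <-].
by exists u => //= x; exact: le_trans (hu x) (fg x).
Qed.

Lemma normL2_le_steps (X : set R) (u : R -> R[i]) (T : seq (R * R * R)) (Q : R) :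
  0 <= Q -> (forall p, p \in T -> 0 <= p.2) ->
  (forall x, X x -> normc (u x) ^+ 2 <= \sum_(p <- T) p.2 * (x \in `[p.1.1, p.1.2])%:R) ->
  \sum_(p <- T) p.2 * mass mu p.1 <= Q ^+ 2 -> (normL2 mu X u <= Q%:E)%E.
Proof.
move=> Q0 T0 uT sumT; rewrite /normL2 unlock.
have -> : Q%:E = ((Q ^+ 2)%:E `^ 2^-1)%E.
  rewrite poweR_EFin -powR_mulrn// -powRrM divff// powRr1//.
apply: gt0_ler_poweR => //.
- by rewrite in_itv/= leey andbT integral_ge0// => x _; exact: poweR_ge0.
- by rewrite in_itv/= leey andbT lee_fin sqr_ge0.
pose ind (p : R * R * R) : measurableTypeR R -> R := \1_(`[p.1.1, p.1.2]%classic : set (measurableTypeR R)).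
apply: (@le_trans _ _ (\int[mu]_x (\sum_(p <- T) `|p.2|%:E * (ind p x)%:E))%E).
  apply: ge0_integral_mono => [x|x]; first exact: poweR_ge0.
  have -> : (\sum_(p <- T) `|p.2|%:E * (ind p x)%:E)%E = (\sum_(p <- T) p.2 * (x \in `[p.1.1, p.1.2])%:R)%:E.
    rewrite -sumEFin big_seq [RHS]big_seq; apply: eq_bigr => p pT.
    by rewrite ger0_norm ?T0// -EFinM /ind indicE mem_setE.
  rewrite /= patchE; case: ifPn => [/set_mem xX|_].
    by rewrite lee_fin ger0_norm ?normc_ge0// powR_mulrn ?normc_ge0// uT.
  (* Outside [X] the restriction takes the default value, which is zero. *)
  rewrite -[X in `|X|]/(0 : R) normr0 powR0// lee_fin big_seq sumr_ge0// => p pT.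
  by rewrite mulr_ge0 ?T0// ler0n.
have mi p : measurable_fun setT (fun x => (ind p x)%:E).
  by apply/measurable_EFinP; apply: measurable_indic; exact: measurable_itv.
have i0 p x : (0 <= (ind p x)%:E)%E by rewrite lee_fin /ind indicE ler0n.
rewrite ge0_integral_sum//; first last.
- by move=> p x _; rewrite mule_ge0// lee_fin.
- by move=> p; apply: measurable_funeM.
rewrite (le_trans _ (_ : ((\sum_(p <- T) p.2 * mass mu p.1)%:E <= _)%E)) ?lee_fin//.
rewrite -sumEFin big_seq [leRHS]big_seq le_eqVlt; apply/orP; left; apply/eqP.
apply: eq_bigr => p pT.
rewrite ge0_integralZl_EFin// integral_indic//.
by rewrite setIT ger0_norm ?T0// EFinM massE.
Qed.

End Majorants.

Section Constants.
Variable R : realType.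

(** A gain of [A ^- 40] at each scale against [L = A ^ 11] per scale; as
    [ln L] is at most [L], the exponent [A ^- 80] is attained with a wide
    margin. *)
Lemma contraction_rate (A : R) : 200 <= A -> 1 - A ^- 40 <= (A ^+ 11) `^ (- (2 * A ^- 80)).
Proof.
move=> A200; have A0 : 0 < A by apply: lt_le_trans A200; rewrite ltr0n.
have A1 : 1 <= A by apply: le_trans A200; rewrite ler1n.
have L0 : 0 < A ^+ 11 by rewrite exprn_gt0.
have lnL : ln (A ^+ 11) <= A ^+ 11.
  have := @le_ln1Dx R (A ^+ 11 - 1); rewrite (addrC 1) subrK => h.
  by rewrite (le_trans (h _))//; lra.
rewrite /powR gt_eqF//; apply: le_trans (expR_ge1Dx _).
rewrite mulNr lerD2l lerN2.
have i80 : 0 < A ^- 80 by rewrite invr_gt0 exprn_gt0.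
apply: (@le_trans _ _ (2 * A ^- 80 * A ^+ 11)); first by rewrite ler_wpM2l// mulr_ge0// ltW.
have i : A ^+ 11 = A ^- 29 * A ^+ 40 by field; rewrite gt_eqF.
have E80 : A ^- 80 = A ^- 40 * A ^- 40 by rewrite -invfM -exprD.
have -> : 2 * A ^- 80 * A ^+ 11 = A ^- 40 * (2 * A ^- 29).
  by rewrite E80 i; field; rewrite gt_eqF.
rewrite ler_piMr ?invr_ge0 ?exprn_ge0 ?(ltW A0)//.
rewrite ler_pdivrMr ?exprn_gt0// mul1r.
rewrite (@le_trans _ _ A)//; last by rewrite ler_eXnr.
by apply: le_trans A200; rewrite ler_nat.
Qed.

(** All losses of the regularity are dominated by powers of this number,
    the reciprocal of whose 80th power is the exponent. *)
Definition loss (delta delta' CR : R) : R :=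
  (5 * CR) `^ (1 / (delta * (1 - delta)) + 1 / (delta' * (1 - delta'))).

Lemma lossC delta delta' CR : loss delta delta' CR = loss delta' delta CR.
Proof. by rewrite /loss addrC. Qed.

Lemma loss_bounds (delta delta' CR : R) : 0 < delta < 1 -> 0 < delta' < 1 -> 1 <= CR ->
  let A := loss delta delta' CR in
  [/\ 200 <= A, (6 * CR ^+ 2) `^ (1 - delta)^-1 <= A ^+ 2,
      (5 * CR) `^ (2 / delta) <= A ^+ 2 & CR ^+ 2 <= A].
Proof.
move=> /andP[d0 d1] /andP[d0' d1'] C1 A.
pose E := 1 / (delta * (1 - delta)) + 1 / (delta' * (1 - delta')).
have e1 : 0 < delta * (1 - delta) <= 1 / 4.
  by apply/andP; split; [rewrite mulr_gt0//; lra|have := sqr_ge0 (delta - 1 / 2); lra].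
have e1' : 0 < delta' * (1 - delta') <= 1 / 4.
  by apply/andP; split; [rewrite mulr_gt0//; lra|have := sqr_ge0 (delta' - 1 / 2); lra].
have inv4 (z : R) : 0 < z <= 1 / 4 -> 4 <= 1 / z.
  by move=> /andP[z0 z4]; rewrite ler_pdivlMr//; lra.
have E1 := inv4 _ e1; have E2 := inv4 _ e1'.
have C5 : 5 <= 5 * CR by lra.
have C50 : 0 <= 5 * CR by lra.
have C51 : 1 <= 5 * CR by lra.
have A2 : A ^+ 2 = (5 * CR) `^ (E * 2).
  by rewrite powRrM powR_mulrn ?powR_ge0.
have E_ge z z' : 0 < z -> 0 < z' -> z * z' = delta * (1 - delta) -> z' <= 1 -> z^-1 <= E.
  move=> z0 z'0 zz z1; apply: (@le_trans _ _ (1 / (delta * (1 - delta)))); last by rewrite /E; lra.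
  by rewrite -zz div1r lef_pV2 ?posrE ?mulr_gt0// ler_piMr// ltW.
have pow2 : (5 * CR) ^+ 2 <= A.
  rewrite -powR_mulrn//; apply: ler_powR => //; rewrite /E in E1 E2 *; lra.
split.
- apply: le_trans (_ : 5 `^ 4%:R <= _); last first.
    apply: le_trans (_ : (5 * CR) `^ 4%:R <= _); last by apply: ler_powR => //; lra.
    by apply: ge0_ler_powR; rewrite ?nnegrE//; lra.
  by rewrite powR_mulrn// -natrX ler_nat.
- rewrite A2 (mulrC E) powRrM; apply: le_trans (_ : ((5 * CR) `^ 2) `^ (1 - delta)^-1 <= _).
    apply: ge0_ler_powR; rewrite ?nnegrE ?invr_ge0 ?powR_ge0//; first by lra.
      by rewrite mulr_ge0// sqr_ge0.
    by rewrite powR_mulrn//; have := sqr_ge0 CR; lra.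
  apply: ler_powR; last by apply: (E_ge _ delta) => //; lra.
  by rewrite powR_mulrn// exprn_ege1.
- rewrite A2; apply: ler_powR => //; rewrite (mulrC E) ler_wpM2l//.
  by apply: (E_ge _ (1 - delta)) => //; lra.
- by rewrite (le_trans _ pow2)//; have := sqr_ge0 CR; lra.
Qed.

Lemma eps0E (delta delta' CR : R) : eps0 delta delta' CR = loss delta delta' CR ^- 80.
Proof.
rewrite /eps0 /loss mulNr powRN (mulrC 80) powRrM; congr (_^-1).
by rewrite powR_mulrn// powR_ge0.
Qed.

End Constants.

(** * The operator bound *)

Section GlobalBound.
Variables (R : realType) (a b c d : R).
Hypotheses (ab : a < b) (cd : c < d).
Local Notation I0 := (`[a, b]%classic).
Local Notation J0 := (`[c, d]%classic).

Lemma symbol_bounds (G : R -> R -> R[i]) : C1_rect_complex I0 J0 G ->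
  exists Gm Gl : R, [/\ 0 <= Gm, 0 <= Gl,
    forall x y, I0 x -> J0 y -> normc (G x y) <= Gm &
    forall x x' y, I0 x -> I0 x' -> J0 y -> normc (G x y - G x' y) <= Gl * `|x - x'| ].
Proof.
move=> [[dRe cRe cRex _] [dIm cIm cImx _]].
have [M1 M10 h1] := continuous_rect_bounded ab cd cRe.
have [M2 M20 h2] := continuous_rect_bounded ab cd cIm.
have [M3 M30 h3] := continuous_rect_bounded ab cd cRex.
have [M4 M40 h4] := continuous_rect_bounded ab cd cImx.
have lip (g : R -> R) M : (forall x, I0 x -> derivable_on I0 g x) ->
    (forall x, I0 x -> `|derive_on I0 g x| <= M) ->
    forall x x', I0 x -> I0 x' -> `|g x - g x'| <= M * `|x - x'|.
  move=> dg gM x x'; wlog xx' : x x' / x' <= x => [H Ix Ix'|].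
    have [|/ltW] := leP x' x => l; first exact: H.
    by rewrite distrC (distrC x); apply: H.
  rewrite /= !in_itv/= => /andP[ax xb] /andP[ax' xb'].
  have [z /andP[z1 z2] ->] := mvt_on dg ax' xx' xb.
  rewrite normrM ler_wpM2r// gM// /= in_itv/=; apply/andP; split; lra.
exists (M1 + M2), (M3 + M4); split; [lra|lra| |].
- move=> x y Ix Jy; rewrite (le_trans (normc_le_Re_Im _))// lerD//; [exact: h1|exact: h2].
- move=> x x' y Ix Ix' Jy; rewrite (le_trans (normc_le_Re_Im _))// !raddfB/= mulrDl lerD//.
    apply: (lip (fun t => complex.Re (G t y)) M3) => // z Iz; last exact: h3.
    by have [] := dRe z y Iz Jy.
  apply: (lip (fun t => complex.Im (G t y)) M4) => // z Iz; last exact: h4.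
  by have [] := dIm z y Iz Jy.
Qed.

Variables (Phi : R -> R -> R) (G : R -> R -> R[i]) (Gm Gl h A r m M q : R).
Hypotheses (C2 : C2_rect I0 J0 Phi) (C1 : C1_rect_complex I0 J0 G).
Hypotheses (Gm0 : 0 <= Gm) (Gl0 : 0 <= Gl).
Hypothesis G_le : forall x y, I0 x -> J0 y -> normc (G x y) <= Gm.
Hypothesis G_lip : forall x x' y, I0 x -> I0 x' -> J0 y ->
  normc (G x y - G x' y) <= Gl * `|x - x'|.
Hypotheses (h_gt0 : 0 < h) (A_large : 200 <= A).
Hypotheses (r_gt0 : 0 < r) (m_gt0 : 0 < m) (M_gt0 : 0 < M).
Hypothesis twists : forall I J : R * R, a <= I.1 -> I.1 <= I.2 -> I.2 <= b ->
  c <= J.1 -> J.1 <= J.2 -> J.2 <= d -> I.2 - I.1 <= r -> J.2 - J.1 <= r ->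
  exists2 k, m <= k <= M & twist Phi k I J.
Hypotheses (q_ge0 : 0 <= q) (rate : 1 - A ^- 40 <= (A ^+ 11) `^ (- q)).
Variables (X Y : set R) (muX muY : {finite_measure set (measurableTypeR R) -> \bar R}).
Hypotheses (MX : multiscale A h X muX) (MY : multiscale A h Y muY).
Hypotheses (XI0 : X `<=` I0) (YJ0 : Y `<=` J0).
Variables (e1 Mx My Q : R).
Hypotheses (e1_gt0 : 0 < e1) (e1_le1 : e1 <= 1) (e1_r : A ^+ 2 * e1 <= r) (e1_M : M * e1 <= 1).
Hypotheses (massX : mass muX (a, b) <= Mx) (massY : mass muY (c, d) <= My).
Hypothesis Q_ge0 : 0 <= Q.
Hypothesis Q_large : Mx * (My + 1) ^+ 2 * (4 * (Gm + Gl) ^+ 2) *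
  (h * A ^+ 11 / (m * e1 ^+ 2)) `^ q <= Q ^+ 2.

Lemma oscB_normL2 (f : R -> R[i]) : inL2 muY Y f -> (normL2 muY Y f <= 1)%E ->
  (normL2 muX X (oscB Phi G Y muY h f) <= Q%:E)%E.
Proof.
move=> fL2 f1; have [fRe fIm _] := fL2.
have [mX nX [lenX _ _ _]] := MX; have [mY nY [lenY posY _ _]] := MY.
have [fi fi2 fl] := inL2_integrable mY fL2 f1.
have A0 : 0 < A by apply: lt_le_trans A_large; rewrite ltr0n.
have A1 : 1 <= A by apply: le_trans A_large; rewrite ler1n.
have L0 : 0 < A ^+ 11 by rewrite exprn_gt0.
have [mX0 mY0] : 0 <= mass muX (a, b) /\ 0 <= mass muY (c, d) by rewrite !mass_ge0.
have Q_le := Q_large; have [Mx0 My0] : 0 <= Mx /\ 0 <= My.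
  by split; [exact: le_trans mX0 massX|exact: le_trans mY0 massY].
set P := (h * A ^+ 11 / (m * e1 ^+ 2)) `^ q in Q_le *.
have me0 : 0 < m * e1 ^+ 2 by rewrite mulr_gt0// exprn_gt0.
have P0 : 0 <= P by exact: powR_ge0.
have Gml : 0 <= Gm + Gl by rewrite addr_ge0.
have [small|large] := leP h (m * e1 ^+ 2); last first.
  (* There is no scale to descend: the trivial bound, with [P >= 1]. *)
  apply: (normL2_le_steps (T := [:: ((a, b), (Gm * (mass muY (c, d) + 1)) ^+ 2)])) => //.
  - by move=> p; rewrite inE => /eqP -> /=; exact: sqr_ge0.
  - move=> x /XI0 Ix; rewrite big_seq1 /= (Ix : x \in `[a, b]) mulr1.
    rewrite ler_sqr ?nnegrE ?normc_ge0 ?mulr_ge0 ?addr_ge0//.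
    exact: (oscB_le h C2 C1 G_le mY nY YJ0 fRe fIm fi fi2).
  - rewrite big_seq1 /=; apply: le_trans Q_le.
    have P1 : 1 <= P.
      rewrite -(powRr0 (h * A ^+ 11 / (m * e1 ^+ 2))); apply: ler_powR => //.
      rewrite ler_pdivlMr// mul1r (le_trans (ltW large))// ler_peMr ?(ltW h_gt0)//.
      exact: exprn_ege1.
    have s1 : Gm ^+ 2 <= 4 * (Gm + Gl) ^+ 2.
      have : Gm ^+ 2 <= (Gm + Gl) ^+ 2 by rewrite ler_sqr ?nnegrE// lerDl.
      by have := sqr_ge0 (Gm + Gl); lra.
    have s2 : (mass muY (c, d) + 1) ^+ 2 <= (My + 1) ^+ 2.
      by rewrite ler_sqr ?nnegrE ?addr_ge0// lerD2r.
    have z := sqr_ge0 Gm.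
    have : (mass muY (c, d) + 1) ^+ 2 * mass muX (a, b) <= (My + 1) ^+ 2 * Mx.
      by rewrite ler_pM ?sqr_ge0.
    move=> s3; have := ler_pM (sqr_ge0 Gm) (mulr_ge0 (sqr_ge0 _) mX0) s1 s3.
    have -> : (Gm * (mass muY (c, d) + 1)) ^+ 2 * mass muX (a, b) =
      Gm ^+ 2 * ((mass muY (c, d) + 1) ^+ 2 * mass muX (a, b)) by ring.
    move=> s4; apply: (le_trans s4).
    have E : Mx * (My + 1) ^+ 2 * (4 * (Gm + Gl) ^+ 2) =
       4 * (Gm + Gl) ^+ 2 * ((My + 1) ^+ 2 * Mx) by ring.
    by rewrite E ler_peMr// !mulr_ge0 ?sqr_ge0 ?addr_ge0//.
have isoX : isolated X e1 (a, b).
  by move=> x /XI0 Ix; rewrite (Ix : x \in `[a, b]).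
have isoY : isolated Y e1 (c, d).
  by move=> y /YJ0 Jy; rewrite (Jy : y \in `[c, d]).
have [spX csX] := piecesP e1_gt0 isoX; have [spY csY] := piecesP e1_gt0 isoY.
set sX := pieces X e1 (a, b) in spX csX; set sY := pieces Y e1 (c, d) in spY csY.
have mM : m <= M.
  have [k /andP[k1 k2] _] := twists (I := (a, a)) (J := (c, c)) (lexx _) (lexx _) (ltW ab)
     (lexx _) (lexx _) (ltW cd) ltac:(rewrite /= subrr; exact: ltW) ltac:(rewrite /= subrr; exact: ltW).
  exact: le_trans k1 k2.
have he1 : h <= e1 <= 1.
  rewrite e1_le1 andbT (le_trans small)// expr2 mulrA ler_piMl ?(ltW e1_gt0)//.
  by rewrite (le_trans _ e1_M)// ler_wpM2r// ltW.
have massJ J : J \in sY -> 0 < mass muY J.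
  by move=> /csY; exact: posY.
pose D J := Rintegral muY (in_cell Y J) (fun y => normc (f y) ^+ 2).
pose K0 := 4 * (Gm + Gl) ^+ 2 * P.
pose good I J (T : seq (R * R * R)) := [/\ forall p, p \in T -> 0 <= p.2,
    forall x, X x -> x \in `[I.1, I.2] -> exists2 p, p \in T &
      x \in `[p.1.1, p.1.2] /\ normc (amplitude Phi G h Y muY f J x) ^+ 2 <= p.2 &
    (\sum_(p <- T) p.2 * mass muX p.1) * mass muY J <= K0 * mass muX I * D J].
have ex_good I J : I \in sX -> J \in sY -> exists T, good I J T.
  move=> Is Js; have cI := csX _ Is; have cJ := csY _ Js.
  have II : subitv I (a, b) := splits_sub spX Is.
  have JJ : subitv J (c, d) := splits_sub spY Js.
  have [I12 _ _ _] := cI; have [J12 _ _ _] := cJ.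
  have lI := le_trans (lenX _ _ he1 cI) e1_r; have lJ := le_trans (lenY _ _ he1 cJ) e1_r.
  have [k /andP[mk kM] tw] := twists II.1 I12 II.2 JJ.1 J12 JJ.2 lI lJ.
  have k0 : 0 < k := lt_le_trans m_gt0 mk.
  have ke1 : k * e1 <= 1 by rewrite (le_trans _ e1_M)// ler_wpM2r// ltW.
  have mk2 : m * e1 ^+ 2 <= k * e1 ^+ 2 by rewrite ler_wpM2r// sqr_ge0.
  have e1i : 0 < e1 <= 1 by rewrite e1_gt0.
  have [T [T1 T2 T3]] := pair_estimate C2 C1 G_le G_lip h_gt0 mY nY YJ0 fRe fIm fi fi2
    A_large MX MY Gm0 Gl0 cI cJ II JJ tw k0 e1i ke1 (le_trans small mk2) q_ge0 rate.
  exists T; split => //; apply: (le_trans T3).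
  rewrite ler_wpM2r ?Rintegral_ge0//; first by move=> y _; exact: sqr_ge0.
  rewrite ler_wpM2r ?mass_ge0// ler_wpM2l ?mulr_ge0 ?sqr_ge0//.
  apply: ge0_ler_powR => //.
  - by rewrite nnegrE ltW// divr_gt0 ?mulr_gt0 ?exprn_gt0.
  - by rewrite nnegrE ltW// divr_gt0 ?mulr_gt0.
  - apply: ler_wpM2l; first by rewrite ltW// mulr_gt0.
    by rewrite lef_pV2 ?posrE// mulr_gt0// exprn_gt0.
pose tab I J := xget [::] (good I J).
have tabP I J : I \in sX -> J \in sY -> good I J (tab I J).
  by move=> Is Js; have [T gT] := ex_good I J Is Js; exact: (xgetPex [::] (ex_intro _ T gT)).
pose W := mass muY (c, d).
pose T := flatten [seq flatten [seq [seq (p.1, W * mass muY J * p.2) | p <- tab U J] | U <- sX] | J <- sY].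
have sumTE (phi : R * R * R -> R) : \sum_(p <- T) phi p =
   \sum_(J <- sY) \sum_(I <- sX) \sum_(p <- tab I J) phi (p.1, W * mass muY J * p.2).
  rewrite big_flatten/= big_map; apply: eq_bigr => J _.
  by rewrite big_flatten/= big_map; apply: eq_bigr => I _; rewrite big_map.
apply: (normL2_le_steps (T := T)) => //.
- move=> p /flatten_mapP[J Js /flatten_mapP[I Is /mapP[p' p's ->]]] /=.
  have [h0 _ _] := tabP I J Is Js.
  by rewrite !mulr_ge0 ?mass_ge0// h0.
- move=> x Xx; have Ix := XI0 Xx.
  apply: (le_trans (oscB_sqr_le h C2 C1 G_le mY nY YJ0 fRe fIm fi Ix spY massJ)).
  rewrite sumTE mulr_sumr big_seq [leRHS]big_seq; apply: ler_sum => J Js.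
  have [I Is xI] := splits_cover spX Xx (Ix : x \in `[a, b]).
  have [_ /(_ x Xx xI)[p pT [xp hp]] _] := tabP I J Is Js.
  have nonneg I' : I' \in sX -> 0 <= \sum_(p <- tab I' J) W * mass muY J * p.2 * (x \in `[p.1.1, p.1.2])%:R.
    move=> I's; have [h0 _ _] := tabP I' J I's Js.
    rewrite big_seq sumr_ge0// => p' p's; by rewrite !mulr_ge0 ?mass_ge0 ?h0.
  rewrite (big_rem I)//= -[leLHS]addr0; apply: lerD; last first.
    by rewrite big_seq sumr_ge0// => I' /mem_rem; exact: nonneg.
  have [h0 _ _] := tabP I J Is Js.
  rewrite (big_rem p)//= xp mulr1 -[leLHS]addr0; apply: lerD; last first.
    by rewrite big_seq sumr_ge0// => p' /mem_rem p's; rewrite !mulr_ge0 ?mass_ge0 ?h0.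
  by rewrite mulrA ler_wpM2l// mulr_ge0 ?mass_ge0.
- rewrite sumTE; apply: le_trans Q_le.
  apply: (@le_trans _ _ (\sum_(J <- sY) \sum_(I <- sX) W * (K0 * mass muX I * D J))).
    rewrite big_seq [leRHS]big_seq; apply: ler_sum => J Js.
    rewrite big_seq [leRHS]big_seq; apply: ler_sum => I Is.
    have [_ _ h3] := tabP I J Is Js.
    apply: le_trans (ler_wpM2l mY0 h3).
    rewrite mulr_suml mulr_sumr le_eqVlt; apply/orP; left; apply/eqP.
    by apply: eq_bigr => p _ /=; rewrite /W; ring.
  have -> : \sum_(J <- sY) \sum_(I <- sX) W * (K0 * mass muX I * D J) =
     W * K0 * mass muX (a, b) * D (c, d).
    rewrite /D (sqr_integral_splits mY fi2 spY) (mass_splits mX nX spX).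
    rewrite mulr_sumr; apply: eq_bigr => J _; rewrite mulr_sumr mulr_suml.
    by apply: eq_bigr => I _; ring.
  have D1 : D (c, d) <= 1 by rewrite /D (in_cell_all YJ0).
  have K00 : 0 <= K0 by rewrite !mulr_ge0// sqr_ge0.
  have WK : 0 <= W * K0 * mass muX (a, b) by rewrite !mulr_ge0.
  rewrite (le_trans (ler_wpM2l WK D1))// mulr1.
  have W1 : W <= (My + 1) ^+ 2.
    by rewrite /W; have := massY; have := My0; nra.
  have s3 : W * mass muX (a, b) <= (My + 1) ^+ 2 * Mx by rewrite ler_pM.
  have := ler_wpM2l K00 s3; rewrite /K0; lra.
Qed.

End GlobalBound.

Theorem theorem1 (R : realType) (delta delta' CR : R) (a b c d : R)
    (Phi : R -> R -> R) (G : R -> R -> R[i]) :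
  0 < delta < 1 -> 0 < delta' < 1 -> 1 <= CR ->
  a < b -> c < d ->
  let I0 := `[a, b]%classic in
  let J0 := `[c, d]%classic in
  C2_rect I0 J0 Phi ->
  (forall x y : R, I0 x -> J0 y -> partial_y J0 (partial_x I0 Phi) x y != 0) ->
  C1_rect_complex I0 J0 G ->
  exists C : R, 0 < C /\
    forall (h : R)
      (X : set R) (muX : {finite_measure set (measurableTypeR R) -> \bar R})
      (Y : set R) (muY : {finite_measure set (measurableTypeR R) -> \bar R}),
      0 < h < 1 ->
      regular delta h CR X muX -> X `<=` I0 ->
      regular delta' h CR Y muY -> Y `<=` J0 ->
      (opnormL2 Y muY X muX (oscB Phi G Y muY h)
        <= (C * h `^ eps0 delta delta' CR)%:E)%E.
Proof.
move=> d01 d01' CR1 ab cd I0 J0 C2 nz C1.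
pose A := loss delta delta' CR.
have [A200 A_len A_sep A_mass] := loss_bounds d01 d01' CR1.
have [_ A_len' A_sep' _] := loss_bounds d01' d01 CR1.
rewrite -/A in A200 A_len A_sep A_mass.
rewrite -lossC -/A in A_len' A_sep'.
have A0 : 0 < A by apply: lt_le_trans A200; rewrite ltr0n.
have A1 : 1 <= A by apply: le_trans A200; rewrite ler1n.
have [r [m [M [r0 m0 M0 twists]]]] := local_twist ab cd C2 nz.
have [Gm [Gl [Gm0 Gl0 G_le G_lip]]] := symbol_bounds ab cd C1.
(* Cells at scale [e1] are short enough for [local_twist], and the condition
   [M * e1 <= 1] keeps all the scales above [h]. *)
pose e1 := Num.min 1 (Num.min (r / A ^+ 2) M^-1).
have e1_gt0 : 0 < e1 by rewrite !lt_min ltr01 divr_gt0 ?exprn_gt0// invr_gt0.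
have e1_le1 : e1 <= 1 by rewrite ge_min lexx.
have e1_r : A ^+ 2 * e1 <= r.
  by rewrite mulrC -ler_pdivlMr ?exprn_gt0// !ge_min lexx !orbT.
have e1_M : M * e1 <= 1.
  by rewrite mulrC -ler_pdivlMr// div1r !ge_min lexx !orbT.
pose Mx := CR * (b - a + 1) `^ delta; pose My := CR * (d - c + 1) `^ delta'.
pose eps := eps0 delta delta' CR; pose q := 2 * eps.
have epsE : eps = A ^- 80 by rewrite /eps eps0E.
have eps_ge0 : 0 <= eps by rewrite epsE invr_ge0 exprn_ge0// ltW.
have q_ge0 : 0 <= q by rewrite mulr_ge0.
have rate : 1 - A ^- 40 <= (A ^+ 11) `^ (- q) by rewrite /q epsE; exact: contraction_rate.
pose S := Mx * (My + 1) ^+ 2 * (4 * (Gm + Gl) ^+ 2) * (A ^+ 11 / (m * e1 ^+ 2)) `^ q.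
have CR0 : 0 < CR by lra.
have S0 : 0 <= S.
  apply: mulr_ge0; last exact: powR_ge0.
  apply: mulr_ge0; last by rewrite mulr_ge0 ?sqr_ge0.
  by apply: mulr_ge0; [rewrite mulr_ge0 ?powR_ge0// ltW|exact: sqr_ge0].
exists (Num.sqrt S + 1); split; first by rewrite ltr_wpDl// sqrtr_ge0.
move=> h X muX Y muY /andP[h0 h1] regX XI regY YJ.
apply: ge_ereal_sup => _ [f [fL2 f1] <-].
have MX : multiscale A h X muX by exact: (regular_multiscale d01 h0 regX).
have MY : multiscale A h Y muY.
  exact: (regular_multiscale d01' h0 regY).
have massX : mass muX (a, b) <= Mx.
  apply: (regular_mass_le regX) => /=; lra.
have massY : mass muY (c, d) <= My.
  apply: (regular_mass_le regY) => /=; lra.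
have Q0 : 0 <= (Num.sqrt S + 1) * h `^ eps by rewrite mulr_ge0 ?addr_ge0 ?sqrtr_ge0 ?powR_ge0.
apply: (oscB_normL2 ab cd C2 C1 Gm0 Gl0 G_le G_lip h0 A200 r0 m0 twists q_ge0 rate
  MX MY XI YJ e1_gt0 e1_le1 e1_r e1_M massX massY Q0 _ fL2 f1).
have L0 : 0 < A ^+ 11 by rewrite exprn_gt0.
have -> : h * A ^+ 11 / (m * e1 ^+ 2) = h * (A ^+ 11 / (m * e1 ^+ 2)) by rewrite mulrA.
rewrite powRM ?(ltW h0)//; last by rewrite ltW// divr_gt0// mulr_gt0// exprn_gt0.
have hq : h `^ q = (h `^ eps) ^+ 2.
  by rewrite /q mulrC powRrM powR_mulrn// powR_ge0.
rewrite mulrCA -/S hq exprMn mulrC ler_wpM2r ?sqr_ge0//.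
by rewrite -[leLHS](sqr_sqrtr S0) ler_sqr ?nnegrE ?addr_ge0 ?sqrtr_ge0// lerDl.
Qed.
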